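(* Let $\varepsilon,\delta_1,\delta_2,\psi$ be real numbers satisfying $\varepsilon>0$, $\pi/2<\delta_1\leqslant\pi$, $\pi/2<\delta_2\leqslant\pi$ and $$\frac{\pi}{2}-\delta_2<\psi<-\frac{\pi}{2}+\delta_1 .$$ Then for every $s\in\mathbb{C}$ $$\frac{1}{\Gamma(s)}=\frac{1}{2\pi i}\int_{\gamma(\varepsilon,\psi,\delta_1,\delta_2)} e^{t}\,t^{-s}\,dt,$$ where the contour $\gamma(\varepsilon,\psi,\delta_1,\delta_2)$ consists of the half-line $S_1=\{t:\ \arg t=-\delta_1+\psi,\ |t|\geqslant\varepsilon\}$, the circular arc $C_\varepsilon=\{t:\ -\delta_1+\psi\leqslant\arg t\leqslant\delta_2+\psi,\ |t|=\varepsilon\}$ and the half-line $S_2=\{t:\ \arg t=\delta_2+\psi,\ |t|\geqslant\varepsilon\}$, traversed in this order in the positive direction.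
   Context: $\Gamma$ is the Euler gamma function, and $1/\Gamma$ is understood as an entire function (equal to $0$ at the poles of $\Gamma$). The contour is traversed in the positive direction: $S_1$ from infinity to $|t|=\varepsilon$, then $C_\varepsilon$ counterclockwise with $\arg t$ increasing from $-\delta_1+\psi$ to $\delta_2+\psi$, then $S_2$ from $|t|=\varepsilon$ to infinity. The complex plane is cut along the ray whose lower bank is $\arg t=\psi-\pi$ and whose upper bank is $\arg t=\psi+\pi$; the power is $t^{-s}=\exp\{-s(\ln|t|+i\arg t)\}$, with $\arg t\in[\psi-\pi,\psi+\pi]$ having on each part of the contour the value(s) stated in the definition of the contour (so if $\delta_1=\delta_2=\pi$ the two half-lines run along the two banks of the cut). *)

(* Defs.v *)
From Stdlib Require Import Reals ZArith Lra Lia.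
From Coquelicot Require Import Coquelicot.

Open Scope R_scope.

Definition Cexp (z : C) : C :=
  (exp (Re z) * cos (Im z), exp (Re z) * sin (Im z)).

(* Improper Riemann integral at both ends; it converges exactly for
   [0 < Re s], and [RInt_gen] is only meaningful there. *)
Definition Gamma_integral (s : C) : C :=
  RInt_gen (V := C_R_CompleteNormedModule)
    (fun x : R => (Cexp ((s - 1) * ln x) * exp (- x))%C)
    (at_right 0) (Rbar_locally p_infty).

(* s (s + 1) ... (s + n - 1) *)
Fixpoint rising (s : C) (n : nat) : C :=
  match n with
  | O => 1%C
  | S m => (rising s m * (s + INR m))%C
  end.

(* The least natural number n with 0 < Re s + n. *)
Definition Gamma_shift (s : C) : nat := Z.to_nat (up (- Re s)).

(* Analytic continuation through Gamma (s + n) = s (s+1) ... (s+n-1) Gamma s;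
   the value is meaningful only when s is not a pole 0, -1, -2, ... *)
Definition Gamma (s : C) : C :=
  (Gamma_integral (s + INR (Gamma_shift s)) / rising s (Gamma_shift s))%C.

(* The entire function 1/Gamma. Since [Gamma_integral] has no zeros on
   0 < Re s, the quotient is a genuine one for every s. *)
Definition recip_Gamma (s : C) : C :=
  (rising s (Gamma_shift s) / Gamma_integral (s + INR (Gamma_shift s)))%C.

Lemma Gamma_shift_pos (s : C) : 0 < Re s + INR (Gamma_shift s).
Proof.
unfold Gamma_shift.
destruct (archimed (- Re s)) as [H1 H2].
destruct (Z_le_gt_dec 0 (up (- Re s))) as [Hz | Hz].
- rewrite INR_IZR_INZ, Z2Nat.id by exact Hz. lra.
- replace (Z.to_nat (up (- Re s))) with 0%nat by lia.
  assert (IZR (up (- Re s)) < 0) by (apply IZR_lt; lia).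
  simpl. lra.
Qed.

Lemma rising_eq0 (s : C) (n m : nat) :
  (m < n)%nat -> s = (- INR m)%C -> rising s n = 0%C.
Proof.
intros Hmn Hs. induction n as [|n IH]; [lia|].
simpl. destruct (Nat.eq_dec m n) as [<- | Hne].
- rewrite Hs. ring.
- rewrite IH by lia. ring.
Qed.

Lemma rising_neq0 (s : C) (n : nat) :
  (forall m : nat, s <> (- INR m)%C) -> rising s n <> 0%C.
Proof.
intros Hs. induction n as [|n IH]; simpl.
- intros H. apply (f_equal Re) in H. simpl in H. lra.
- apply Cmult_neq_0; [exact IH|].
  intros H. apply (Hs n).
  replace s with (s + INR n - INR n)%C by ring.
  rewrite H. ring.
Qed.

Lemma recip_Gamma_pole (m : nat) : recip_Gamma (- INR m)%C = 0%C.
Proof.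
unfold recip_Gamma, Cdiv.
rewrite (rising_eq0 _ _ m); [ring| |reflexivity].
assert (H := Gamma_shift_pos (- INR m)%C).
simpl in H. apply INR_lt. lra.
Qed.

Lemma recip_GammaE (s : C) :
  (forall m : nat, s <> (- INR m)%C) ->
  Gamma_integral (s + INR (Gamma_shift s)) <> 0%C ->
  recip_Gamma s = (/ Gamma s)%C.
Proof.
intros Hs HG. unfold recip_Gamma, Gamma.
field. split; [now apply rising_neq0 | exact HG].
Qed.

(* A point of a contour is given by its modulus r > 0 and its argument theta in R (not
   reduced mod 2 pi), so the two banks of a cut are distinct. *)
Definition polar (r theta : R) : C := (r * Cexp (Ci * theta))%C.

(* t ^ z = exp (z (ln |t| + i arg t)) *)
Definition polar_power (r theta : R) (z : C) : C :=
  Cexp (z * (ln r + Ci * theta)).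

(* f r theta is the value of the integrand at the point of modulus r and
   argument theta. The three pieces below are t = r exp (i theta), with r
   decreasing from infinity to eps (dt = exp (i theta) dr), then theta
   increasing along the circle |t| = eps (dt = i t dtheta), then r increasing
   from eps to infinity; [is_RInt_gen] respects the order of its endpoints. *)
Definition is_ray_in_integral (f : R -> R -> C) (eps theta : R) (I : C) : Prop :=
  is_RInt_gen (V := C_R_NormedModule)
    (fun r : R => (f r theta * Cexp (Ci * theta))%C)
    (Rbar_locally p_infty) (at_point eps) I.

Definition is_arc_integral (f : R -> R -> C) (eps theta1 theta2 : R) (I : C) : Prop :=
  is_RInt (V := C_R_NormedModule)
    (fun theta : R => (f eps theta * (Ci * polar eps theta))%C)
    theta1 theta2 I.

Definition is_ray_out_integral (f : R -> R -> C) (eps theta : R) (I : C) : Prop :=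
  is_RInt_gen (V := C_R_NormedModule)
    (fun r : R => (f r theta * Cexp (Ci * theta))%C)
    (at_point eps) (Rbar_locally p_infty) I.

(* All three pieces converge and I is the integral of f over
   gamma (eps, psi, delta1, delta2) = S1, then C_eps, then S2. *)
Definition is_gamma_contour_integral
    (f : R -> R -> C) (eps psi delta1 delta2 : R) (I : C) : Prop :=
  exists I1 I2 I3 : C,
    is_ray_in_integral f eps (- delta1 + psi) I1 /\
    is_arc_integral f eps (- delta1 + psi) (delta2 + psi) I2 /\
    is_ray_out_integral f eps (delta2 + psi) I3 /\
    I = (I1 + I2 + I3)%C.

(* Main.v *)
Require Import Defs.
From Stdlib Require Import Reals Factorial Lra Lia.
From Coquelicot Require Import Coquelicot.
Open Scope R_scope.

(** Write [A s r] for the integral of [exp t * t^(-s)] over the arc of radius [r]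
between the two arguments of the contour.

The contour integral is the limit of [A s r] as [r] grows.  In the polar
coordinates [t = r e^(i theta)] the ray integrand [F = f e^(i theta)] and the arc
integrand [i r F] satisfy [d/dr (i r F) = d/dtheta F], because [f] is holomorphic
in [log t]; so [A s] has as its derivative the difference of the two ray integrands
([is_derive_arc_integral]), and the two rays carry the arc of radius [eps] out to
infinity ([contour_integral_arc_limit]).  Where the cosine of the argument is
negative, [exp t] makes the arcs negligible, so the endpoints of the arc may be moved to
[-pi] and [pi] ([arc_limit_full_circle]).  Let [L s] be the resulting limit; the
theorem says that [L s] is [2 pi i] times the reciprocal gamma function.

Integration by parts gives [L s = s L (s + 1)] and
[Gamma (z + 1) = z Gamma z], so that the product [L z * Gamma z] has period 1 on the
right half-plane.  It is computed by letting the argument go to infinity, which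
takes the place of the reflection formula and of analytic continuation.  For fixed [z] with
[1 <= Re z <= 2] and [n] a large integer, both factors are compared with their
values at [n]:

 - [Gamma (z + n)] is close to [n^z * (n - 1)!] ([Gamma_asymptotic]), because the
   probability density [x^(n-1) e^(-x) / (n-1)!] has mean [n] and standard deviation
   [sqrt n], so that [(x / n)^z] is close to 1 where it matters;

 - [L (z + n) * n^z * (n - 1)!] is close to [2 pi i] ([arc_limit_asymptotic]),
   because on the circle of radius [n], through the saddle point of
   [exp t * t^(-n)], the modulus of the integrand is at most a Gaussian in the
   argument, whose mass times the Stirling bound on [(n - 1)!] is bounded, while
   the factor [e^(-i z theta)] tends to 1 at the centre.  For the exponent [n] itself
   the integral over the circle is exactly [2 pi i / (n - 1)!] ([arc_integral_nat]).

Both relative errors are at most a constant over [sqrt n], hence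
[L z * Gamma z = 2 pi i] ([arc_limit_mult_Gamma]).  In particular the gamma integral has no
zero on the right half-plane, and the recurrence of [L] carries the identity to
every [s]. *)

(** * Calculus of complex-valued functions of real variables *)

Lemma C_ext (z w : C) : Re z = Re w -> Im z = Im w -> z = w.
Proof. destruct z, w; simpl; intros; f_equal; assumption. Qed.

Ltac by_Re_Im := apply C_ext; unfold Re, Im; simpl; unfold Re, Im.

(** Restates at type [C] an equation that unification has left at the carrier of a
   normed module, where [ring] and [field] do not recognise it. *)
Ltac eq_in_C := cbv beta; match goal with |- @eq _ ?x ?y => change (@eq C x y) end.

Lemma Cexp_plus (z w : C) : Cexp (z + w) = (Cexp z * Cexp w)%C.
Proof.
  unfold Cexp; simpl.
  rewrite exp_plus, cos_plus, sin_plus.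
  by_Re_Im; ring.
Qed.

Lemma Cmod_Cexp (z : C) : Cmod (Cexp z) = exp (Re z).
Proof.
  unfold Cmod, Cexp; simpl.
  assert (H : exp (Re z) * cos (Im z) * (exp (Re z) * cos (Im z) * 1) +
    exp (Re z) * sin (Im z) * (exp (Re z) * sin (Im z) * 1)
    = Rsqr (exp (Re z))).
  { assert (H := sin2_cos2 (Im z)). unfold Rsqr in *.
    transitivity (exp (Re z) * exp (Re z) * (sin (Im z) * sin (Im z) + cos (Im z) * cos (Im z)));
    [ring | rewrite H; ring]. }
  rewrite H. apply sqrt_Rsqr, Rlt_le, exp_pos.
Qed.

Lemma Cmod_Ci : Cmod Ci = 1.
Proof. unfold Cmod; simpl. transitivity (sqrt 1); [f_equal; ring | apply sqrt_1]. Qed.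

Lemma Cexp_0 : Cexp 0 = 1%C.
Proof. unfold Cexp; simpl. rewrite exp_0, cos_0, sin_0. by_Re_Im; ring. Qed.

Lemma Cexp_neq_0 (z : C) : Cexp z <> 0%C.
Proof.
  intros H. apply (f_equal Cmod) in H.
  rewrite Cmod_Cexp, Cmod_0 in H. generalize (exp_pos (Re z)); lra.
Qed.

Lemma Cexp_RtoC (x : R) : Cexp x = RtoC (exp x).
Proof. unfold Cexp, RtoC; simpl. rewrite cos_0, sin_0. by_Re_Im; ring. Qed.

(** The product norm of [R * R], which the integrals below use, is the complex
   modulus; every estimate passes through this bridge. *)
Lemma norm_C (z : C) : @norm R_AbsRing C_R_NormedModule z = Cmod z.
Proof.
  unfold Cmod, norm; simpl. unfold prod_norm, norm; simpl. unfold abs; simpl.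
  f_equal. rewrite !Rmult_1_r, <- !Rabs_mult, !Rabs_pos_eq;
    [reflexivity | apply Rle_0_sqr..].
Qed.

Lemma continuous_C {U : UniformSpace} (f : U -> C) (x : U) :
  continuous (fun t => Re (f t)) x -> continuous (fun t => Im (f t)) x ->
  continuous f x.
Proof.
  intros H1 H2.
  apply (continuous_ext (fun t => (Re (f t), Im (f t)))).
  { intros t; destruct (f t); reflexivity. }
  apply filterlim_locally; intros eps.
  generalize (proj1 (filterlim_locally _ _) H1 eps).
  generalize (proj1 (filterlim_locally _ _) H2 eps).
  intros A B; generalize (filter_and _ _ A B).
  apply filter_imp. intros t [H3 H4]; split; simpl; assumption.
Qed.

Lemma continuous_Re {U : UniformSpace} (f : U -> C) (x : U) :
  continuous f x -> continuous (fun t => Re (f t)) x.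
Proof. intros H. apply (continuous_comp f fst); [exact H|]. destruct (f x); apply continuous_fst. Qed.

Lemma continuous_Im {U : UniformSpace} (f : U -> C) (x : U) :
  continuous f x -> continuous (fun t => Im (f t)) x.
Proof. intros H. apply (continuous_comp f snd); [exact H|]. destruct (f x); apply continuous_snd. Qed.

Lemma continuous_Cplus {U : UniformSpace} (f g : U -> C) (x : U) :
  continuous f x -> continuous g x -> continuous (fun t => f t + g t)%C x.
Proof.
  intros Hf Hg.
  apply (continuous_plus (V := C_R_NormedModule) f g x Hf Hg).
Qed.

Lemma continuous_Cmult {U : UniformSpace} (f g : U -> C) (x : U) :
  continuous f x -> continuous g x -> continuous (fun t => f t * g t)%C x.
Proof.
  intros Hf Hg. apply continuous_C; simpl.
  - apply (continuous_minus (V := R_NormedModule)).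
    + apply (continuous_mult (K := R_AbsRing)); apply continuous_Re; assumption.
    + apply (continuous_mult (K := R_AbsRing)); apply continuous_Im; assumption.
  - apply (continuous_plus (V := R_NormedModule)).
    + apply (continuous_mult (K := R_AbsRing)); [apply continuous_Re|apply continuous_Im]; assumption.
    + apply (continuous_mult (K := R_AbsRing)); [apply continuous_Im|apply continuous_Re]; assumption.
Qed.

Lemma continuous_RtoC {U : UniformSpace} (f : U -> R) (x : U) :
  continuous f x -> continuous (fun t => RtoC (f t)) x.
Proof.
  intros Hf. apply continuous_C; simpl; [exact Hf|apply continuous_const].
Qed.

Lemma continuous_Cexp {U : UniformSpace} (f : U -> C) (x : U) :
  continuous f x -> continuous (fun t => Cexp (f t)) x.
Proof.
  intros Hf.
  assert (H1 := continuous_Re f x Hf). assert (H2 := continuous_Im f x Hf).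
  apply continuous_C; simpl; apply (continuous_mult (K := R_AbsRing)).
  - apply (continuous_comp _ exp); [exact H1|apply continuous_exp].
  - apply (continuous_comp _ cos); [exact H2|apply continuous_cos].
  - apply (continuous_comp _ exp); [exact H1|apply continuous_exp].
  - apply (continuous_comp _ sin); [exact H2|apply continuous_sin].
Qed.

Notation is_derive_C f x l :=
  (is_derive (K := R_AbsRing) (V := C_R_NormedModule) f x l) (only parsing).

(** Reduces complex differentiation to the real and imaginary parts, where the real
   product and chain rules apply. *)
Lemma is_derive_pair_C (f : R -> C) (x : R) (l : C) :
  is_derive (fun t => Re (f t)) x (Re l) -> is_derive (fun t => Im (f t)) x (Im l) ->
  is_derive_C f x l.
Proof.
  intros H1 H2.
  generalize (is_derive_plus (V := C_R_NormedModule) _ _ x _ _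
    (is_derive_scal_l (V := C_R_NormedModule) _ x _ (RtoC 1) H1)
    (is_derive_scal_l (V := C_R_NormedModule) _ x _ Ci H2)).
  intros H.
  replace l with (@plus C_R_NormedModule (scal (Re l) (RtoC 1)) (scal (Im l) Ci)).
  - apply (is_derive_ext (V := C_R_NormedModule)) with (2 := H).
    intros t. by_Re_Im; unfold plus, scal; simpl; unfold mult; simpl; ring.
  - by_Re_Im; unfold plus, scal; simpl; unfold mult; simpl; ring.
Qed.

Lemma is_derive_Re (f : R -> C) (x : R) (l : C) :
  is_derive_C f x l -> is_derive (fun t => Re (f t)) x (Re l).
Proof.
  intros H.
  assert (Hl : filterdiff (fst : C_R_NormedModule -> R_NormedModule) (locally (f x)) fst)
    by apply filterdiff_linear, is_linear_fst.
  exact (filterdiff_comp' f fst x _ _ H Hl).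
Qed.

Lemma is_derive_Im (f : R -> C) (x : R) (l : C) :
  is_derive_C f x l -> is_derive (fun t => Im (f t)) x (Im l).
Proof.
  intros H.
  assert (Hl : filterdiff (snd : C_R_NormedModule -> R_NormedModule) (locally (f x)) snd)
    by apply filterdiff_linear, is_linear_snd.
  exact (filterdiff_comp' f snd x _ _ H Hl).
Qed.

Lemma is_derive_Cplus (f g : R -> C) (x : R) (lf lg : C) :
  is_derive_C f x lf -> is_derive_C g x lg ->
  is_derive_C (fun t => f t + g t)%C x (lf + lg)%C.
Proof. exact (is_derive_plus (V := C_R_NormedModule) f g x lf lg). Qed.

Lemma is_derive_Rmult (f g : R -> R) (x lf lg : R) :
  is_derive f x lf -> is_derive g x lg ->
  is_derive (fun t => f t * g t) x (lf * g x + f x * lg).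
Proof.
  intros Hf Hg. apply (is_derive_mult f g x lf lg Hf Hg).
  intros; apply Rmult_comm.
Qed.

Lemma is_derive_Cmult (f g : R -> C) (x : R) (lf lg : C) :
  is_derive_C f x lf -> is_derive_C g x lg ->
  is_derive_C (fun t => f t * g t)%C x (lf * g x + f x * lg)%C.
Proof.
  intros Hf Hg.
  assert (H1 := is_derive_Re _ _ _ Hf). assert (H2 := is_derive_Im _ _ _ Hf).
  assert (H3 := is_derive_Re _ _ _ Hg). assert (H4 := is_derive_Im _ _ _ Hg).
  apply is_derive_pair_C; simpl.
  - evar_last.
    + apply (is_derive_minus (V := R_NormedModule));
        apply is_derive_Rmult; eassumption.
    + unfold minus, plus, opp; simpl. unfold Re, Im; ring.
  - evar_last.
    + apply (is_derive_plus (V := R_NormedModule));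
        apply is_derive_Rmult; eassumption.
    + unfold plus; simpl. unfold Re, Im; ring.
Qed.

Lemma is_derive_RtoC (f : R -> R) (x l : R) :
  is_derive f x l -> is_derive_C (fun t => RtoC (f t)) x (RtoC l).
Proof.
  intros H. apply is_derive_pair_C; simpl; [exact H|].
  apply (is_derive_const (V := R_NormedModule)).
Qed.

Lemma is_derive_Cconst (c : C) (x : R) : is_derive_C (fun _ => c) x (RtoC 0).
Proof. apply (is_derive_const (V := C_R_NormedModule)). Qed.

Lemma is_derive_Cexp (f : R -> C) (x : R) (l : C) :
  is_derive_C f x l -> is_derive_C (fun t => Cexp (f t)) x (l * Cexp (f x))%C.
Proof.
  intros H.
  assert (H1 := is_derive_Re _ _ _ H). assert (H2 := is_derive_Im _ _ _ H).
  assert (He : is_derive (fun t => exp (Re (f t))) x (Re l * exp (Re (f x))))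
    by (apply (is_derive_comp exp _ x _ _ (is_derive_exp _) H1)).
  assert (Hc : is_derive (fun t => cos (Im (f t))) x (Im l * - sin (Im (f x))))
    by (apply (is_derive_comp cos _ x _ _ (is_derive_cos _) H2)).
  assert (Hs : is_derive (fun t => sin (Im (f t))) x (Im l * cos (Im (f x))))
    by (apply (is_derive_comp sin _ x _ _ (is_derive_sin _) H2)).
  apply is_derive_pair_C; simpl.
  - evar_last.
    + apply is_derive_Rmult; eassumption.
    + simpl. unfold Re, Im. ring.
  - evar_last.
    + apply is_derive_Rmult; eassumption.
    + simpl. unfold Re, Im. ring.
Qed.

Lemma is_derive_C_continuous (f : R -> C) (x : R) (l : C) :
  is_derive_C f x l -> continuous f x.
Proof. intros H. apply (ex_derive_continuous (V := C_R_NormedModule)). now exists l. Qed.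

(** * Integrals of vector-valued functions *)

Lemma is_RInt_Cmult_l (c : C) (f : R -> C) (a b : R) (l : C) :
  is_RInt (V := C_R_NormedModule) f a b l ->
  is_RInt (V := C_R_NormedModule) (fun t => c * f t)%C a b (c * l)%C.
Proof.
  intros H.
  assert (H1 := is_RInt_fct_extend_fst (U := R_NormedModule) (V := R_NormedModule) f a b l H).
  assert (H2 := is_RInt_fct_extend_snd (U := R_NormedModule) (V := R_NormedModule) f a b l H).
  apply (is_RInt_fct_extend_pair (U := R_NormedModule) (V := R_NormedModule)); simpl.
  - apply (is_RInt_minus (V := R_NormedModule)); apply (is_RInt_scal (V := R_NormedModule)); assumption.
  - apply (is_RInt_plus (V := R_NormedModule)); apply (is_RInt_scal (V := R_NormedModule)); assumption.
Qed.

Lemma is_RInt_gen_Cmult_l (c : C) (f : R -> C) (Fa Fb : (R -> Prop) -> Prop) (l : C)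
    {FFa : Filter Fa} {FFb : Filter Fb} :
  is_RInt_gen (V := C_R_NormedModule) f Fa Fb l ->
  is_RInt_gen (V := C_R_NormedModule) (fun t => c * f t)%C Fa Fb (c * l)%C.
Proof.
  intros H P HP.
  assert (Hc : continuous (fun z : C => c * z)%C l).
  { apply continuous_Cmult; [apply continuous_const | apply continuous_id]. }
  generalize (H _ (Hc P HP)).
  apply (filter_imp (F := filter_prod Fa Fb)). intros ab [y [Hy1 Hy2]].
  exists (c * y)%C; split; [apply is_RInt_Cmult_l|]; assumption.
Qed.

(** The fundamental theorem of calculus for improper integrals with values in a
   complete normed space. Regularity is asked for on an interval [D] only, since the
   ends may be singular for [df], as 0 is for powers. *)
Lemma is_RInt_gen_of_derive {V : CompleteNormedModule R_AbsRing}
    (Fa Fb : (R -> Prop) -> Prop) {FFa : Filter Fa} {FFb : Filter Fb}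
    (D : R -> Prop) (f df : R -> V) (la lb : V) :
  (forall x y z, D x -> D y -> x <= z <= y -> D z) -> Fa D -> Fb D ->
  (forall x, D x -> is_derive f x (df x)) -> (forall x, D x -> continuous df x) ->
  filterlim f Fa (locally la) -> filterlim f Fb (locally lb) ->
  is_RInt_gen df Fa Fb (minus lb la).
Proof.
  intros HD Ha Hb Hf Hdf Hla Hlb P HP.
  assert (Hlim : filterlim (fun ab => minus (f (snd ab)) (f (fst ab)))
      (filter_prod Fa Fb) (locally (minus lb la))).
  { apply (filterlim_comp_2 (G := locally lb) (H := locally (opp la))
      (fun ab => f (snd ab)) (fun ab => opp (f (fst ab))) plus).
    - eapply filterlim_comp; [apply filterlim_snd | exact Hlb].
    - apply (filterlim_comp _ _ _ (fun ab : R * R => f (fst ab)) opp _ (locally la)).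
      + eapply filterlim_comp; [apply filterlim_fst | exact Hla].
      + apply (filterlim_opp la).
    - apply (filterlim_plus lb (opp la)). }
  assert (HDD : filter_prod Fa Fb (fun ab => D (fst ab) /\ D (snd ab))).
  { exists D D; auto. }
  assert (HP' := Hlim P HP). unfold filtermap in HP'. unfold filtermapi.
  generalize (filter_and _ _ HDD HP').
  apply filter_imp. intros [a b] [[Da Db] HPab]; simpl in *.
  exists (minus (f b) (f a)); split; [|exact HPab].
  assert (Hin : forall x, Rmin a b <= x <= Rmax a b -> D x).
  { intros x. unfold Rmin, Rmax; destruct (Rle_dec a b); intros Hx; [apply (HD a b) | apply (HD b a)];
    auto. }
  apply is_RInt_derive; auto.
Qed.

Lemma norm_RInt_dominated {V : CompleteNormedModule R_AbsRing}
    (f : R -> V) (g : R -> R) (a b : R) :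
  (forall x, Rmin a b <= x <= Rmax a b -> norm (f x) <= g x) ->
  ex_RInt f a b -> ex_RInt g a b -> norm (RInt f a b) <= Rabs (RInt g a b).
Proof.
  intros Hfg Hf Hg.
  destruct (Rle_dec a b) as [Hab | Hab].
  - rewrite Rmin_left, Rmax_right in Hfg by assumption.
    apply Rle_trans with (2 := Rle_abs _).
    apply (norm_RInt_le f g a b); auto; [apply (RInt_correct f) | apply (RInt_correct g)]; auto.
  - assert (Hba : b <= a) by lra.
    rewrite Rmin_right, Rmax_left in Hfg by assumption.
    apply ex_RInt_swap in Hf. apply ex_RInt_swap in Hg.
    rewrite <- (opp_RInt_swap f b a Hf), <- (opp_RInt_swap g b a Hg).
    apply Rle_trans with (1 := Req_le _ _ (norm_opp (RInt f b a))).
    apply Rle_trans with (2 := Req_le _ _ (eq_sym (Rabs_Ropp (RInt g b a)))).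
    apply Rle_trans with (2 := Rle_abs _).
    apply (norm_RInt_le f g b a); auto; [apply (RInt_correct f) | apply (RInt_correct g)]; auto.
Qed.

(** Comparison test. A convergent integral of [g] makes its integrals over short
   pieces near the two ends small, and these dominate those of [f]; the integrals of
   [f] are therefore Cauchy along the product filter. *)
Lemma ex_RInt_gen_dominated {V : CompleteNormedModule R_AbsRing}
    (Fa Fb : (R -> Prop) -> Prop) {FFa : ProperFilter Fa} {FFb : ProperFilter Fb}
    (D : R -> Prop) (f : R -> V) (g : R -> R) (lg : R) :
  (forall x y z, D x -> D y -> x <= z <= y -> D z) -> Fa D -> Fb D ->
  (forall x, D x -> continuous f x) -> (forall x, D x -> continuous g x) ->
  (forall x, D x -> norm (f x) <= g x) ->
  is_RInt_gen g Fa Fb lg ->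
  exists l, is_RInt_gen f Fa Fb l.
Proof.
  intros HD Ha Hb Hf Hg Hfg Hlg.
  assert (Hin : forall a b, D a -> D b -> forall x, Rmin a b <= x <= Rmax a b -> D x).
  { intros a b Da Db x. unfold Rmin, Rmax.
    destruct (Rle_dec a b); intros Hx; [apply (HD a b) | apply (HD b a)]; auto. }
  assert (If : forall a b, D a -> D b -> ex_RInt f a b).
  { intros a b Da Db. apply ex_RInt_continuous. intros x Hx. eauto. }
  assert (Ig : forall a b, D a -> D b -> ex_RInt g a b).
  { intros a b Da Db. apply (ex_RInt_continuous (V := R_CompleteNormedModule)). intros x Hx. eauto. }
  assert (Hle : forall a b, D a -> D b -> norm (RInt f a b) <= Rabs (RInt g a b)).
  { intros a b Da Db. apply norm_RInt_dominated; auto. intros x Hx. apply Hfg. eauto. }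
  destruct (proj1 (filterlim_locally_closely (F := filter_prod Fa Fb)
      (fun ab => RInt f (fst ab) (snd ab)))) as [l Hl].
  { refine (proj2 (filterlim_closely (F := filter_prod Fa Fb)
      (fun ab => RInt f (fst ab) (snd ab))) _). intros eps.
    assert (Heps : 0 < eps / 4) by (generalize (cond_pos eps); lra).
    (* Each of the two pieces by which the intervals differ is a difference of two
       integrals of [g], so it costs [2 * eps / 4]. *)
    assert (HB : locally lg (fun y => Rabs (y - lg) < eps / 4)).
    { exists (mkposreal _ Heps). intros y Hy. exact Hy. }
    destruct (Hlg _ HB) as [Q R' HQ HR HQR].
    exists (fun ab => (Q (fst ab) /\ D (fst ab)) /\ (R' (snd ab) /\ D (snd ab))). split.
    { exists (fun a => Q a /\ D a) (fun b => R' b /\ D b);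
        [now apply filter_and | now apply filter_and | now auto]. }
    destruct (filter_ex _ (filter_and _ _ HQ Ha)) as [a0 [Qa0 Da0]].
    destruct (filter_ex _ (filter_and _ _ HR Hb)) as [b0 [Rb0 Db0]].
    assert (Hest : forall a b, Q a -> D a -> R' b -> D b -> Rabs (RInt g a b - lg) < eps / 4).
    { intros a b Qa Da Rb Db. destruct (HQR a b Qa Rb) as [y [Hy1 Hy2]]; simpl in Hy1.
      rewrite (is_RInt_unique _ _ _ _ Hy1). exact Hy2. }
    intros [a b] [a' b'] [[Qa Da] [Rb Db]] [[Qa' Da'] [Rb' Db']]; simpl in *.
    apply (norm_compat1 (K := R_AbsRing) (V := V) (RInt f a b) (RInt f a' b') eps).
    assert (Ha' : norm (RInt f a' a) <= Rabs (RInt g a' a)) by auto.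
    assert (Hb' : norm (RInt f b b') <= Rabs (RInt g b b')) by auto.
    assert (E : minus (RInt f a' b') (RInt f a b) = plus (RInt f a' a) (RInt f b b')).
    { rewrite <- (RInt_Chasles f a' a b') by auto.
      rewrite <- (RInt_Chasles f a b b') by auto.
      assert (HG : forall (G : AbelianGroup) (A X Y : G),
          minus (plus A (plus X Y)) X = plus A Y).
      { intros G A X Y. change (plus (plus A (plus X Y)) (opp X) = plus A Y).
        rewrite (plus_comm X Y), (plus_assoc A Y X), <- (plus_assoc (plus A Y) X (opp X)).
        rewrite plus_opp_r. apply plus_zero_r. }
      apply HG. }
    apply Rle_lt_trans with (norm (plus (RInt f a' a) (RInt f b b'))).
    { apply Req_le. exact (f_equal norm E). }
    apply Rle_lt_trans with (norm (RInt f a' a) + norm (RInt f b b')).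
    { exact (norm_triangle (V := V) (RInt f a' a) (RInt f b b')). }
    assert (E1 := RInt_Chasles g a' a b (Ig _ _ Da' Da) (Ig _ _ Da Db)).
    assert (E2 := RInt_Chasles g a b b' (Ig _ _ Da Db) (Ig _ _ Db Db')).
    unfold plus in E1, E2; simpl in E1, E2.
    assert (K1 := Hest a b Qa Da Rb Db).
    assert (K2 := Hest a' b Qa' Da' Rb Db).
    assert (K3 := Hest a b' Qa Da Rb' Db').
    revert Ha' Hb' K1 K2 K3. unfold Rabs; repeat destruct Rcase_abs; intros; lra. }
  exists l. intros P HP.
  assert (HDD : filter_prod Fa Fb (fun ab => D (fst ab) /\ D (snd ab))).
  { exists D D; auto. }
  assert (HP' := Hl P HP). unfold filtermap in HP'. unfold filtermapi.
  generalize (filter_and _ _ HDD HP').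
  apply filter_imp. intros [a b] [[Da Db] HPab]; simpl in *.
  exists (RInt f a b); split; [apply (RInt_correct f); auto | exact HPab].
Qed.

Lemma Re_RInt (f : R -> C) (a b : R) :
  ex_RInt (V := C_R_NormedModule) f a b ->
  Re (RInt (V := C_R_CompleteNormedModule) f a b) = RInt (fun t => Re (f t)) a b.
Proof.
  intros H. apply (RInt_correct (V := C_R_CompleteNormedModule)) in H.
  symmetry. apply (is_RInt_unique (V := R_CompleteNormedModule)).
  exact (is_RInt_fct_extend_fst (U := R_NormedModule) (V := R_NormedModule) f a b _ H).
Qed.

Lemma Im_RInt (f : R -> C) (a b : R) :
  ex_RInt (V := C_R_NormedModule) f a b ->
  Im (RInt (V := C_R_CompleteNormedModule) f a b) = RInt (fun t => Im (f t)) a b.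
Proof.
  intros H. apply (RInt_correct (V := C_R_CompleteNormedModule)) in H.
  symmetry. apply (is_RInt_unique (V := R_CompleteNormedModule)).
  exact (is_RInt_fct_extend_snd (U := R_NormedModule) (V := R_NormedModule) f a b _ H).
Qed.

Lemma is_derive_RInt_param_R (f df : R -> R -> R) (a b x : R) :
  locally x (fun y => forall t, is_derive (fun u => f u t) y (df y t)) ->
  (forall t, continuous (fun p : R * R => df (fst p) (snd p)) (x, t)) ->
  locally x (fun y => forall t, continuous (f y) t) ->
  is_derive (fun u => RInt (f u) a b) x (RInt (df x) a b).
Proof.
  intros Hd Hc Hf.
  replace (RInt (df x) a b) with (RInt (fun t => Derive (fun u => f u t) x) a b).
  - apply (is_derive_RInt_param f a b x).
    + revert Hd; apply filter_imp; intros y Hy t _. now exists (df y t).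
    + intros t _. apply continuity_2d_pt_ext_loc with df.
      * destruct Hd as [e He]. exists e. intros u v Hu _.
        symmetry. apply is_derive_unique, He. exact Hu.
      * apply continuity_2d_pt_filterlim. apply Hc.
    + revert Hf; apply filter_imp; intros y Hy.
      apply (ex_RInt_continuous (V := R_CompleteNormedModule)). auto.
  - apply RInt_ext. intros t _. apply is_derive_unique, (locally_singleton _ _ Hd).
Qed.

(** Differentiation under the integral sign, obtained from the real case on both
   components. *)
Lemma is_derive_RInt_param_C (f df : R -> R -> C) (a b x : R) :
  locally x (fun y => forall t, is_derive_C (fun u => f u t) y (df y t)) ->
  (forall t, continuous (fun p : R * R => df (fst p) (snd p)) (x, t)) ->
  locally x (fun y => forall t, continuous (f y) t) ->
  is_derive_C (fun u => RInt (V := C_R_CompleteNormedModule) (f u) a b) x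
    (RInt (V := C_R_CompleteNormedModule) (df x) a b).
Proof.
  intros Hd Hc Hf.
  assert (Hdf : ex_RInt (V := C_R_NormedModule) (df x) a b).
  { apply (ex_RInt_continuous (V := C_R_CompleteNormedModule)). intros t _.
    apply (continuous_comp_2 (fun _ => x) (fun t => t) df).
    - apply continuous_const.
    - apply continuous_id.
    - apply Hc. }
  assert (Hef : locally x (fun y => ex_RInt (V := C_R_NormedModule) (f y) a b)).
  { revert Hf; apply filter_imp; intros y Hy.
    apply (ex_RInt_continuous (V := C_R_CompleteNormedModule)). auto. }
  apply is_derive_pair_C.
  - rewrite Re_RInt by assumption.
    apply (is_derive_ext_loc (fun u => RInt (fun t => Re (f u t)) a b)).
    { revert Hef; apply filter_imp; intros y Hy. symmetry; now apply Re_RInt. }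
    apply (is_derive_RInt_param_R (fun u t => Re (f u t)) (fun u t => Re (df u t))).
    + revert Hd; apply filter_imp; intros y Hy t. now apply (is_derive_Re (fun u => f u t)).
    + intros t. now apply continuous_Re.
    + revert Hf; apply filter_imp; intros y Hy t. now apply continuous_Re.
  - rewrite Im_RInt by assumption.
    apply (is_derive_ext_loc (fun u => RInt (fun t => Im (f u t)) a b)).
    { revert Hef; apply filter_imp; intros y Hy. symmetry; now apply Im_RInt. }
    apply (is_derive_RInt_param_R (fun u t => Im (f u t)) (fun u t => Im (df u t))).
    + revert Hd; apply filter_imp; intros y Hy t. now apply (is_derive_Im (fun u => f u t)).
    + intros t. now apply continuous_Im.
    + revert Hf; apply filter_imp; intros y Hy t. now apply continuous_Im.
Qed.

Lemma filterlim_Cmod {T : Type} (F : (T -> Prop) -> Prop) {FF : Filter F} (f : T -> C) (l : C) :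
  filterlim (fun t => Cmod (f t - l)) F (locally 0) <-> filterlim f F (locally l).
Proof.
  split; intros H.
  - apply filterlim_locally; intros eps.
    generalize (proj1 (filterlim_locally _ _) H eps). apply filter_imp. intros t Ht.
    apply (norm_compat1 (V := C_R_NormedModule)).
    rewrite norm_C. unfold ball in Ht; simpl in Ht; unfold AbsRing_ball in Ht; simpl in Ht.
    unfold abs, minus, plus, opp in Ht; simpl in Ht.
    rewrite Ropp_0, Rplus_0_r, Rabs_pos_eq in Ht by apply Cmod_ge_0. exact Ht.
  - apply filterlim_locally; intros eps.
    generalize (proj1 (filterlim_locally_ball_norm (U := C_R_NormedModule) _ _) H eps).
    apply filter_imp. intros t Ht. unfold ball_norm in Ht. rewrite norm_C in Ht.
    unfold ball; simpl; unfold AbsRing_ball; simpl.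
    unfold abs, minus, plus, opp; simpl.
    rewrite Ropp_0, Rplus_0_r, Rabs_pos_eq by apply Cmod_ge_0. exact Ht.
Qed.

(** * Powers, exponentials and convergence of the gamma integral *)

(** The source of every decay estimate: an exponential beats a power. *)
Lemma ln_le_linear (a b : R) : 0 < b ->
  exists M, 0 < M /\ forall x, M < x -> a * ln x <= b * x.
Proof.
  intros Hb.
  assert (He : 0 < b / (Rabs a + 1)) by (apply Rdiv_lt_0_compat; generalize (Rabs_pos a); lra).
  destruct (proj2 (is_lim_spec _ _ _) is_lim_div_ln_p (mkposreal _ He)) as [M HM]; simpl in HM.
  exists (Rmax M 1). split; [apply Rlt_le_trans with (2 := Rmax_r _ _); lra|].
  intros x Hx.
  assert (H1 : 1 < x) by (apply Rle_lt_trans with (1 := Rmax_r M 1); exact Hx).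
  assert (H2 : M < x) by (apply Rle_lt_trans with (1 := Rmax_l M 1); exact Hx).
  specialize (HM x H2). rewrite Rminus_0_r in HM.
  assert (Ha := Rabs_pos a).
  assert (Hl : 0 <= ln x) by (rewrite <- ln_1; apply ln_le; lra).
  apply Rle_trans with (Rabs a * ln x).
  { apply Rmult_le_compat_r; [exact Hl | apply Rle_abs]. }
  apply Rle_trans with ((Rabs a + 1) * (b / (Rabs a + 1)) * x).
  - rewrite Rabs_pos_eq in HM by (apply Rle_mult_inv_pos; lra).
    assert (H3 : ln x <= b / (Rabs a + 1) * x).
    { replace (ln x) with (ln x / x * x) by (field; lra).
      apply Rmult_le_compat_r; lra. }
    rewrite Rmult_assoc.
    apply Rmult_le_compat; lra.
  - apply Req_le. field. lra.
Qed.

Lemma power_exp_lim_infty (a b : R) : 0 < b ->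
  filterlim (fun x => exp (a * ln x - b * x)) (Rbar_locally p_infty) (locally 0).
Proof.
  intros Hb.
  destruct (ln_le_linear a (b / 2)) as [M [HM0 HM]]; [lra|].
  apply filterlim_locally. intros eps.
  exists (Rmax M (- ln eps * (2 / b))). intros x Hx.
  assert (H1 : M < x) by (apply Rle_lt_trans with (1 := Rmax_l _ _) (2 := Hx)).
  assert (H2 : - ln eps * (2 / b) < x) by (apply Rle_lt_trans with (1 := Rmax_r _ _) (2 := Hx)).
  change (Rabs (exp (a * ln x - b * x) - 0) < eps).
  rewrite Rminus_0_r, Rabs_pos_eq by apply Rlt_le, exp_pos.
  rewrite <- (exp_ln eps) by apply cond_pos.
  apply exp_increasing.
  specialize (HM x H1).
  assert (- ln eps < b / 2 * x).
  { replace (- ln eps) with (b / 2 * (- ln eps * (2 / b))) by (field; lra).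
    apply Rmult_lt_compat_l; lra. }
  lra.
Qed.

Lemma power_exp_lim_0 (a b : R) : 0 < a -> 0 < b ->
  filterlim (fun x => exp (a * ln x - b * x)) (at_right 0) (locally 0).
Proof.
  intros Ha Hb. apply filterlim_locally. intros eps.
  exists (mkposreal _ (exp_pos (ln eps / a))). intros x Hx Hx0.
  change (Rabs (x - 0) < exp (ln eps / a)) in Hx.
  rewrite Rminus_0_r, Rabs_pos_eq in Hx by lra.
  change (Rabs (exp (a * ln x - b * x) - 0) < eps).
  rewrite Rminus_0_r, Rabs_pos_eq by apply Rlt_le, exp_pos.
  rewrite <- (exp_ln eps) by apply cond_pos.
  apply exp_increasing.
  apply ln_increasing in Hx; [|exact Hx0]. rewrite ln_exp in Hx.
  assert (a * ln x < ln eps).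
  { replace (ln eps) with (a * (ln eps / a)) by (field; lra). now apply Rmult_lt_compat_l. }
  assert (0 < b * x) by (apply Rmult_lt_0_compat; lra).
  lra.
Qed.

Lemma exp_le (x y : R) : x <= y -> exp x <= exp y.
Proof. intros [H | ->]; [apply Rlt_le, exp_increasing, H | apply Rle_refl]. Qed.

Lemma pow_exp_ln (x : R) (n : nat) : 0 < x -> x ^ n = exp (INR n * ln x).
Proof. intros Hx. rewrite <- Rpower_pow by exact Hx. reflexivity. Qed.

Lemma at_right_pos : at_right 0 (fun x => 0 < x).
Proof. exists (mkposreal 1 Rlt_0_1). intros x _ Hx. exact Hx. Qed.

Lemma p_infty_pos : Rbar_locally p_infty (fun x => 0 < x).
Proof. exists 0. intros x Hx. exact Hx. Qed.

Lemma pos_convex (x y z : R) : 0 < x -> 0 < y -> x <= z <= y -> 0 < z.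
Proof. lra. Qed.

Lemma is_derive_pow_exp (n : nat) (x : R) :
  is_derive (fun x => - (x ^ S n * exp (- x))) x
    (x ^ S n * exp (- x) - INR (S n) * (x ^ n * exp (- x))).
Proof.
  auto_derive; [trivial|]. simpl pred. ring_simplify. simpl. ring.
Qed.

Lemma continuous_pow_exp (n : nat) (x : R) : continuous (fun x => x ^ n * exp (- x)) x.
Proof.
  apply (ex_derive_continuous (V := R_NormedModule)). auto_derive; trivial.
Qed.

Lemma pow_exp_lim_infty (n : nat) :
  filterlim (fun x => x ^ n * exp (- x)) (Rbar_locally p_infty) (locally 0).
Proof.
  eapply filterlim_ext_loc; [|apply (power_exp_lim_infty (INR n) 1); lra].
  exists 0. intros x Hx. rewrite pow_exp_ln by exact Hx. rewrite <- exp_plus. f_equal. ring.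
Qed.

(** Integration by parts. These integrals serve twice: as dominating functions for
   the convergence of the gamma integral, and as moments in its asymptotics. *)
Lemma factorial_integral (n : nat) :
  is_RInt_gen (V := R_NormedModule) (fun x => x ^ n * exp (- x))
    (at_right 0) (Rbar_locally p_infty) (INR (fact n)).
Proof.
  induction n as [|n IH].
  - replace (INR (fact 0)) with (minus (- 0) (-1)) by (unfold minus, plus, opp; simpl; ring).
    apply (is_RInt_gen_of_derive (V := R_CompleteNormedModule)
      (at_right 0) (Rbar_locally p_infty)) with (D := fun x => 0 < x) (f := fun x => - (x ^ 0 * exp (- x))).
    + exact pos_convex.
    + exact at_right_pos.
    + exact p_infty_pos.
    + intros x _. auto_derive; [trivial|]. simpl; ring.
    + intros x _. apply continuous_pow_exp.
    + assert (H : continuous (fun x => - (x ^ 0 * exp (- x))) 0).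
      { apply (continuous_opp (V := R_NormedModule)), continuous_pow_exp. }
      unfold continuous in H. simpl in H. rewrite Ropp_0, exp_0 in H.
      replace (- (1 * 1)) with (-1) in H by ring.
      apply filterlim_filter_le_1 with (2 := H). apply filter_le_within.
    + eapply filterlim_comp; [apply (pow_exp_lim_infty 0)|].
      apply (filterlim_opp (V := R_NormedModule)).
  - assert (H : is_RInt_gen (V := R_NormedModule)
       (fun x => x ^ S n * exp (- x) - INR (S n) * (x ^ n * exp (- x)))
       (at_right 0) (Rbar_locally p_infty) (minus (- 0) (- 0))).
    { apply (is_RInt_gen_of_derive (V := R_CompleteNormedModule)
      (at_right 0) (Rbar_locally p_infty)) with (D := fun x => 0 < x) (f := fun x => - (x ^ S n * exp (- x))).
      + exact pos_convex.
      + exact at_right_pos.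
      + exact p_infty_pos.
      + intros x _. apply is_derive_pow_exp.
      + intros x _. apply (continuous_minus (V := R_NormedModule)); [apply continuous_pow_exp|].
        apply (continuous_scal_r (V := R_NormedModule)), continuous_pow_exp.
      + assert (H : continuous (fun x => - (x ^ S n * exp (- x))) 0).
        { apply (continuous_opp (V := R_NormedModule)), continuous_pow_exp. }
        unfold continuous in H. rewrite pow_ne_zero, Rmult_0_l in H by discriminate.
        apply filterlim_filter_le_1 with (2 := H). apply filter_le_within.
      + eapply filterlim_comp; [apply (pow_exp_lim_infty (S n))|].
        apply (filterlim_opp (V := R_NormedModule)). }
    assert (H2 := is_RInt_gen_plus (V := R_NormedModule) _ _ _ _ H
      (is_RInt_gen_scal (V := R_NormedModule) _ (INR (S n)) _ IH)).
    replace (INR (fact (S n))) with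
      (@plus R_NormedModule (minus (-0) (-0)) (scal (INR (S n)) (INR (fact n)))).
    + eapply (is_RInt_gen_ext (V := R_NormedModule)); [|exact H2].
      apply filter_forall. intros ab x _. unfold plus, scal; simpl. unfold mult; simpl. ring.
    + change (fact (S n)) with (S n * fact n)%nat. rewrite mult_INR.
      unfold plus, scal, minus, plus, opp; simpl. unfold mult; simpl. ring.
Qed.

Definition Rpow_C (x : R) (z : C) : C := Cexp (z * ln x)%C.

Definition Gamma_integrand (z : C) (x : R) : C := (Rpow_C x (z - 1) * exp (- x))%C.

Lemma Cmod_Rpow_C (x : R) (z : C) : Cmod (Rpow_C x z) = exp (Re z * ln x).
Proof. unfold Rpow_C. rewrite Cmod_Cexp. f_equal. unfold Re; simpl. ring. Qed.

Lemma Rpow_C_plus (x : R) (z w : C) : Rpow_C x (z + w) = (Rpow_C x z * Rpow_C x w)%C.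
Proof. unfold Rpow_C. rewrite <- Cexp_plus. f_equal. ring. Qed.

Lemma Rpow_C_1 (x : R) : 0 < x -> Rpow_C x 1 = RtoC x.
Proof.
  intros Hx. unfold Rpow_C. replace (RtoC 1 * ln x)%C with (RtoC (ln x)) by ring.
  rewrite Cexp_RtoC, exp_ln by exact Hx. reflexivity.
Qed.

Lemma is_derive_Rpow_C (x : R) (z : C) : 0 < x ->
  is_derive_C (fun x => Rpow_C x z) x (z * Rpow_C x (z - 1))%C.
Proof.
  intros Hx. unfold Rpow_C at 1. evar_last.
  { apply is_derive_Cexp. apply is_derive_Cmult.
    - apply is_derive_Cconst.
    - apply is_derive_RtoC. apply is_derive_ln. exact Hx. }
  simpl. change (Cexp (z * ln x)) with (Rpow_C x z).
  assert (E : Rpow_C x z = (Rpow_C x (z - 1) * x)%C).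
  { transitivity (Rpow_C x (z - 1) * Rpow_C x 1)%C.
    - rewrite <- Rpow_C_plus. f_equal. ring.
    - now rewrite (Rpow_C_1 x Hx). }
  rewrite E.
  rewrite RtoC_inv by lra. field. intros H. apply RtoC_inj in H. lra.
Qed.

Lemma continuous_Gamma_integrand (z : C) (x : R) : 0 < x -> continuous (Gamma_integrand z) x.
Proof.
  intros Hx. apply continuous_Cmult.
  - eapply is_derive_C_continuous. now apply is_derive_Rpow_C.
  - apply continuous_RtoC. apply (continuous_comp Ropp exp).
    + apply (continuous_opp (V := R_NormedModule)), continuous_id.
    + apply continuous_exp.
Qed.

Lemma Cmod_Gamma_integrand (z : C) (x : R) :
  Cmod (Gamma_integrand z x) = exp ((Re z - 1) * ln x) * exp (- x).
Proof.
  unfold Gamma_integrand. rewrite Cmod_mult, Cmod_Rpow_C, Cmod_R, Rabs_pos_eq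
    by apply Rlt_le, exp_pos.
  reflexivity.
Qed.

Lemma ex_Gamma_integral_ge1 (z : C) : 1 <= Re z ->
  exists G, is_RInt_gen (V := C_R_NormedModule) (Gamma_integrand z)
    (at_right 0) (Rbar_locally p_infty) G.
Proof.
  intros Hz. destruct (nfloor_ex (Re z)) as [N [_ HN]]; [lra|].
  (* [x^(Re z - 1)] is at most 1 for [x <= 1] and at most [x^N] for [x >= 1]. *)
  apply (ex_RInt_gen_dominated (V := C_R_CompleteNormedModule)
      (at_right 0) (Rbar_locally p_infty)) with
    (D := fun x => 0 < x) (g := fun x => x ^ 0 * exp (- x) + x ^ N * exp (- x))
    (lg := INR (fact 0) + INR (fact N)).
  - exact pos_convex.
  - exact at_right_pos.
  - exact p_infty_pos.
  - intros x Hx. now apply continuous_Gamma_integrand.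
  - intros x Hx. apply (continuous_plus (V := R_NormedModule)); apply continuous_pow_exp.
  - intros x Hx. apply Rle_trans with (1 := Req_le _ _ (norm_C _)).
    rewrite Cmod_Gamma_integrand, <- Rmult_plus_distr_r.
    apply Rmult_le_compat_r; [apply Rlt_le, exp_pos|].
    destruct (Rle_dec x 1) as [H1 | H1].
    + apply Rle_trans with 1.
      * apply Rle_trans with (exp 0); [|rewrite exp_0; lra]. apply exp_le.
        assert (ln x <= 0) by (rewrite <- ln_1; apply ln_le; lra). 
        assert (0 <= (Re z - 1) * - ln x) by (apply Rmult_le_pos; lra). lra.
      * simpl. assert (0 <= x ^ N) by (apply pow_le; lra). lra.
    + apply Rle_trans with (x ^ N); [|simpl; lra].
      rewrite pow_exp_ln by exact Hx. apply exp_le.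
      apply Rmult_le_compat_r; [|lra].
      rewrite <- ln_1. apply ln_le; lra.
  - apply (is_RInt_gen_plus (V := R_NormedModule)); apply factorial_integral.
Qed.

Lemma power_exp_C_lim (F : (R -> Prop) -> Prop) {FF : Filter F} (z : C) :
  filterlim (fun x => exp (Re z * ln x - 1 * x)) F (locally 0) ->
  filterlim (fun x => Rpow_C x z * exp (- x))%C F (locally (RtoC 0)).
Proof.
  intros H. apply filterlim_Cmod; [exact FF|].
  eapply filterlim_ext; [|exact H]. intros x; simpl.
  replace (Rpow_C x z * exp (- x) - 0)%C with (Rpow_C x z * exp (- x))%C by ring.
  rewrite Cmod_mult, Cmod_Rpow_C, Cmod_R, Rabs_pos_eq by apply Rlt_le, exp_pos.
  rewrite <- exp_plus. f_equal. ring.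
Qed.

(** The integrand is the derivative of [x^z e^(-x)], which vanishes at both ends.
   This yields the functional equation, and also the convergence for [0 < Re z < 1]
   from that for [1 <= Re z]. *)
Lemma Gamma_by_parts (z : C) : 0 < Re z ->
  is_RInt_gen (V := C_R_NormedModule)
    (fun x => z * Gamma_integrand z x - Gamma_integrand (z + 1) x)%C
    (at_right 0) (Rbar_locally p_infty) (RtoC 0).
Proof.
  intros Hz. replace (RtoC 0) with (@minus C_R_NormedModule (RtoC 0) (RtoC 0))
    by (apply (minus_eq_zero (RtoC 0 : C_R_NormedModule))).
  apply (is_RInt_gen_of_derive (V := C_R_CompleteNormedModule)
      (at_right 0) (Rbar_locally p_infty)) with (D := fun x => 0 < x) (f := fun x => (Rpow_C x z * exp (- x))%C).
  - exact pos_convex.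
  - exact at_right_pos.
  - exact p_infty_pos.
  - intros x Hx. evar_last.
    { apply is_derive_Cmult; [now apply is_derive_Rpow_C|].
      apply is_derive_RtoC. instantiate (1 := (- exp (- x))%R). auto_derive; [trivial|ring]. }
    unfold Gamma_integrand. replace (z + 1 - 1)%C with z by ring.
    rewrite RtoC_opp. ring.
  - intros x Hx. apply (continuous_minus (V := C_R_NormedModule)).
    + apply continuous_Cmult; [apply continuous_const | now apply continuous_Gamma_integrand].
    + now apply continuous_Gamma_integrand.
  - apply power_exp_C_lim; [typeclasses eauto|]. apply power_exp_lim_0; lra.
  - apply power_exp_C_lim; [typeclasses eauto|]. apply power_exp_lim_infty; lra.
Qed.

(** * Functional equation and growth of the gamma integral *)

Lemma C_neq_0_Re (z : C) : 0 < Re z -> z <> 0%C.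
Proof. intros H E. rewrite E in H. simpl in H. lra. Qed.

Lemma Gamma_integral_correct (z : C) : 0 < Re z ->
  is_RInt_gen (V := C_R_NormedModule) (Gamma_integrand z)
    (at_right 0) (Rbar_locally p_infty) (Gamma_integral z).
Proof.
  intros Hz.
  apply (RInt_gen_correct (V := C_R_CompleteNormedModule)).
  destruct (ex_Gamma_integral_ge1 (z + 1)) as [G HG]; [change (1 <= Re z + 1); lra|].
  exists (/ z * (RtoC 0 + G))%C.
  assert (H := is_RInt_gen_Cmult_l (/ z) _ _ _ _
    (is_RInt_gen_plus (V := C_R_NormedModule) _ _ _ _ (Gamma_by_parts z Hz) HG)).
  eapply (is_RInt_gen_ext (V := C_R_NormedModule)); [|exact H].
  apply filter_forall. intros ab x _.
  change (/ z * ((z * Gamma_integrand z x - Gamma_integrand (z + 1) x) + Gamma_integrand (z + 1) x) = Gamma_integrand z x)%C.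
  field. now apply C_neq_0_Re.
Qed.

Lemma Gamma_integral_unique (z G : C) :
  is_RInt_gen (V := C_R_NormedModule) (Gamma_integrand z)
    (at_right 0) (Rbar_locally p_infty) G -> Gamma_integral z = G.
Proof. exact (is_RInt_gen_unique (V := C_R_CompleteNormedModule) _ G). Qed.

Lemma Gamma_integral_succ (z : C) : 0 < Re z ->
  Gamma_integral (z + 1) = (z * Gamma_integral z)%C.
Proof.
  intros Hz. apply Gamma_integral_unique.
  assert (H := is_RInt_gen_minus (V := C_R_NormedModule) _ _ _ _
    (is_RInt_gen_Cmult_l z _ _ _ _ (Gamma_integral_correct z Hz)) (Gamma_by_parts z Hz)).
  replace (z * Gamma_integral z)%C with
    (@minus C_R_NormedModule (z * Gamma_integral z)%C (RtoC 0)).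
  - eapply (is_RInt_gen_ext (V := C_R_NormedModule)); [|exact H].
    apply filter_forall. intros ab x _.
    change (z * Gamma_integrand z x - (z * Gamma_integrand z x - Gamma_integrand (z + 1) x)
      = Gamma_integrand (z + 1) x)%C. ring.
  - change (z * Gamma_integral z - 0 = z * Gamma_integral z)%C. ring.
Qed.

(** [v^z - 1] is the integral of [z t^(z-1)] from 1 to [v], and [t^(Re z - 1)] is at
   most [max 1 t] there. Bounding that power by a polynomial is the reason for
   restricting [Re z]: only moments of order at most two are then needed. *)
Lemma Rpow_C_minus_1_bound (v : R) (z : C) : 0 < v -> 1 <= Re z <= 2 ->
  Cmod (Rpow_C v z - 1) <= Cmod z * Rabs (v - 1) * (1 + v).
Proof.
  intros Hv Hz.
  assert (Hpos : forall t, Rmin 1 v <= t <= Rmax 1 v -> 0 < t).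
  { intros t [Ht _]. apply Rlt_le_trans with (2 := Ht). apply Rmin_glb_lt; lra. }
  assert (H : is_RInt (V := C_R_NormedModule) (fun t => z * Rpow_C t (z - 1))%C 1 v
     (@minus C_R_NormedModule (Rpow_C v z) (Rpow_C 1 z))).
  { apply (is_RInt_derive (V := C_R_CompleteNormedModule) (fun t => Rpow_C t z)).
    - intros t Ht. now apply is_derive_Rpow_C, Hpos.
    - intros t Ht. apply continuous_Cmult; [apply continuous_const|].
      eapply is_derive_C_continuous. now apply is_derive_Rpow_C, Hpos. }
  assert (E : @minus C_R_NormedModule (Rpow_C v z) (Rpow_C 1 z) = (Rpow_C v z - 1)%C).
  { change (Rpow_C v z - Rpow_C 1 z = Rpow_C v z - 1)%C. f_equal. f_equal.
    unfold Rpow_C. rewrite ln_1. replace (z * 0)%C with (RtoC 0) by ring. apply Cexp_0. }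
  rewrite E in H.
  assert (Hb : forall t, Rmin 1 v <= t <= Rmax 1 v ->
    Cmod (z * Rpow_C t (z - 1)) <= Cmod z * (1 + v)).
  { intros t Ht. rewrite Cmod_mult. apply Rmult_le_compat_l; [apply Cmod_ge_0|].
    rewrite Cmod_Rpow_C. assert (Ht0 := Hpos t Ht). simpl.
    destruct (Rle_dec t 1) as [H1 | H1].
    - apply Rle_trans with (exp 0); [|rewrite exp_0; lra]. apply exp_le.
      assert (ln t <= 0) by (rewrite <- ln_1; apply ln_le; lra).
      assert (0 <= (Re z - 1) * - ln t) by (apply Rmult_le_pos; lra).
      unfold Re in *. lra.
    - apply Rle_trans with t.
      + rewrite <- (exp_ln t) at 2 by exact Ht0. apply exp_le.
        assert (0 <= ln t) by (rewrite <- ln_1; apply ln_le; lra).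
        assert (0 <= (2 - Re z) * ln t) by (apply Rmult_le_pos; lra).
        unfold Re in *. lra.
      + unfold Rmax in Ht. destruct (Rle_dec 1 v); lra. }
  assert (B := norm_RInt_le_const_abs (V := C_R_NormedModule) _ _ _ _ (Cmod z * (1 + v))
    (fun t Ht => Rle_trans _ _ _ (Req_le _ _ (norm_C _)) (Hb t Ht)) H).
  rewrite norm_C in B. rewrite (Rmult_comm (Cmod z)), Rmult_assoc. exact B.
Qed.

Lemma Rpow_C_scale (n x : R) (z : C) : 0 < n -> 0 < x ->
  Rpow_C x z = (Rpow_C n z * Rpow_C (x / n) z)%C.
Proof.
  intros Hn Hx. unfold Rpow_C. rewrite <- Cexp_plus. f_equal.
  rewrite ln_div by assumption. rewrite RtoC_minus. ring.
Qed.

Lemma Rpow_C_nat (x : R) (n : nat) : 0 < x -> Rpow_C x (INR n) = RtoC (x ^ n).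
Proof.
  intros Hx. unfold Rpow_C. rewrite <- RtoC_mult, Cexp_RtoC, pow_exp_ln by exact Hx. reflexivity.
Qed.

(** With [v = x / n], the difference is [n^z (v^z - 1) x^m e^(-x)]. The
   arithmetic-geometric inequality splits [|v - 1| (1 + v)] into two squares; the
   weight [a] is chosen later, as [sqrt n], to balance them. *)
Lemma Gamma_ratio_integrand_bound (m : nat) (x a : R) (z : C) :
  0 < x -> 0 < a -> 1 <= Re z <= 2 ->
  let n := INR (S m) in
  Cmod (Gamma_integrand (z + n) x - Rpow_C n z * RtoC (x ^ m * exp (- x))) <=
  exp (Re z * ln n) * Cmod z / 2 *
    (x ^ m * exp (- x) * (a * (x / n - 1) ^ 2 + (x / n + 1) ^ 2 / a)).
Proof.
  intros Hx Ha Hz n.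
  assert (Hn : 0 < n) by (apply lt_0_INR; lia).
  assert (Hv : 0 < x / n) by now apply Rdiv_lt_0_compat.
  assert (He := exp_pos (- x)).
  assert (E : (Gamma_integrand (z + n) x - Rpow_C n z * RtoC (x ^ m * exp (- x)) =
    Rpow_C n z * (Rpow_C (x / n) z - 1) * RtoC (x ^ m * exp (- x)))%C).
  { unfold Gamma_integrand.
    replace (z + n - 1)%C with (z + INR m)%C.
    - rewrite Rpow_C_plus, Rpow_C_nat, (Rpow_C_scale n x z), RtoC_mult by assumption. ring.
    - unfold n. rewrite S_INR, RtoC_plus. ring. }
  rewrite E, !Cmod_mult, Cmod_R, Cmod_Rpow_C.
  assert (Hxm : 0 < x ^ m) by now apply pow_lt.
  rewrite Rabs_pos_eq by (apply Rmult_le_pos; lra).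
  assert (B := Rpow_C_minus_1_bound (x / n) z Hv Hz).
  assert (Q : Rabs (x / n - 1) * (1 + x / n) <= (a * (x / n - 1) ^ 2 + (x / n + 1) ^ 2 / a) / 2).
  { set (v := x / n) in *.
    assert (Hs : 0 <= (a * Rabs (v - 1) - (1 + v)) ^ 2 / (2 * a)).
    { apply Rle_mult_inv_pos; [apply pow2_ge_0 | lra]. }
    assert (Hsq : (v - 1) ^ 2 = Rabs (v - 1) ^ 2) by now rewrite pow2_abs.
    rewrite Hsq.
    replace ((a * Rabs (v - 1) ^ 2 + (v + 1) ^ 2 / a) / 2) with
      ((a * Rabs (v - 1) - (1 + v)) ^ 2 / (2 * a) + Rabs (v - 1) * (1 + v)) by (field; lra).
    lra. }
  set (W := a * (x / n - 1) ^ 2 + (x / n + 1) ^ 2 / a) in *.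
  replace (exp (Re z * ln n) * Cmod z / 2 * (x ^ m * exp (- x) * W)) with
    (exp (Re z * ln n) * (Cmod z * (W / 2)) * (x ^ m * exp (- x))) by field.
  apply Rmult_le_compat_r; [apply Rmult_le_pos; lra|].
  apply Rmult_le_compat_l; [apply Rlt_le, exp_pos|].
  apply Rle_trans with (1 := B). rewrite Rmult_assoc.
  apply Rmult_le_compat_l; [apply Cmod_ge_0 | exact Q].
Qed.

Lemma is_RInt_gen_RtoC (f : R -> R) (Fa Fb : (R -> Prop) -> Prop) (l : R)
    {FFa : Filter Fa} {FFb : Filter Fb} :
  is_RInt_gen (V := R_NormedModule) f Fa Fb l ->
  is_RInt_gen (V := C_R_NormedModule) (fun t => RtoC (f t)) Fa Fb (RtoC l).
Proof.
  intros H P HP.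
  assert (Hc : continuous RtoC l) by apply continuous_RtoC, continuous_id.
  generalize (H _ (Hc P HP)).
  apply (filter_imp (F := filter_prod Fa Fb)). intros ab [y [Hy1 Hy2]].
  exists (RtoC y); split; [|assumption].
  apply (is_RInt_fct_extend_pair (U := R_NormedModule) (V := R_NormedModule)); simpl.
  - exact Hy1.
  - assert (H0 := is_RInt_const (V := R_NormedModule) (fst ab) (snd ab) 0).
    rewrite (scal_zero_r (V := R_NormedModule)) in H0. exact H0.
Qed.

(** For the density [x^m e^(-x) / m!] the ratio [v = x / n] has mean 1 and variance
   [1 / n]. The bound of the integrand therefore integrates to [a / n + 4 / a + 1 /
   (a n)] times the constants, which is at most [6 / a] for [a = sqrt n]. *)
Lemma Gamma_asymptotic (m : nat) (z : C) : 1 <= Re z <= 2 ->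
  let n := INR (S m) in
  Cmod (Gamma_integral (z + n) - Rpow_C n z * INR (fact m)) <=
  3 * Cmod z * exp (Re z * ln n) * INR (fact m) / sqrt n.
Proof.
  intros Hz n.
  assert (Hn : 1 <= n) by (unfold n; rewrite S_INR; generalize (pos_INR m); lra).
  set (a := sqrt n).
  assert (Ha : 0 < a) by (apply sqrt_lt_R0; lra).
  assert (Haa : a * a = n) by (apply sqrt_sqrt; lra).
  set (K := exp (Re z * ln n) * Cmod z / 2).
  assert (HK : 0 <= K).
  { apply Rle_mult_inv_pos; [|lra].
    apply Rmult_le_pos; [apply Rlt_le, exp_pos | apply Cmod_ge_0]. }
  assert (Hre : 0 < Re (z + n)) by (simpl; unfold Re in *; lra).
  assert (Hf := is_RInt_gen_minus (V := C_R_NormedModule) _ _ _ _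
    (Gamma_integral_correct (z + n) Hre)
    (is_RInt_gen_Cmult_l (Rpow_C n z) _ _ _ _
      (is_RInt_gen_RtoC _ _ _ _ (factorial_integral m)))).
  (* Coefficients of [x^m], [x^(m+1)], [x^(m+2)] in the expanded bound. *)
  pose (c0 := K * (a + / a)). pose (c1 := K * (2 / a - 2 * a) / n).
  pose (c2 := K * (a + / a) / (n * n)).
  assert (Hg := is_RInt_gen_plus (V := R_NormedModule) _ _ _ _
     (is_RInt_gen_plus (V := R_NormedModule) _ _ _ _
      (is_RInt_gen_scal (V := R_NormedModule) _ c0 _ (factorial_integral m))
      (is_RInt_gen_scal (V := R_NormedModule) _ c1 _ (factorial_integral (S m))))
      (is_RInt_gen_scal (V := R_NormedModule) _ c2 _ (factorial_integral (S (S m))))).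
  eapply Rle_trans; [|eapply Rle_trans;
    [refine (RInt_gen_norm (V := C_R_CompleteNormedModule)
      (Fa := at_right 0) (Fb := Rbar_locally p_infty) _ _ _ _
      (Filter_prod _ _ _ (fun x => 0 < x < 1) (fun x => 1 < x) _ _ _)
      (Filter_prod _ _ _ (fun x => 0 < x) (fun x => 0 < x) _ _ _) Hf Hg)|]].
  - apply Req_le. symmetry. exact (norm_C _).
  - exists (mkposreal 1 Rlt_0_1). intros y Hy Hy0.
    change (Rabs (y - 0) < 1) in Hy. rewrite Rminus_0_r in Hy.
    split; [exact Hy0 | apply Rle_lt_trans with (1 := Rle_abs y) (2 := Hy)].
  - now exists 1.
  - simpl; intros; lra.
  - exact at_right_pos.
  - exact p_infty_pos.
  - simpl. intros x y Hx Hy t Ht.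
    rewrite norm_C.
    assert (Ht0 : 0 < t) by lra.
    apply Rle_trans with (1 := Gamma_ratio_integrand_bound m t a z Ht0 Ha Hz). fold n.
    apply Req_le. fold K. unfold plus, scal; simpl. unfold mult; simpl.
    unfold c0, c1, c2. field. lra.
  - change (fact (S (S m))) with (S (S m) * (S m * fact m))%nat.
    change (fact (S m)) with (S m * fact m)%nat. rewrite !mult_INR, (S_INR (S m)). fold n.
    unfold plus, scal; simpl. unfold mult; simpl.
    set (f := INR (fact m)). assert (Hf0 : 0 < f) by apply INR_fact_lt_0.
    replace (c0 * f + c1 * (n * f) + c2 * ((n + 1) * (n * f))) with
      (K * f * ((a / n) + 4 / a + / a * / n)).
    2: { unfold c0, c1, c2. field. lra. }
    replace (3 * Cmod z * exp (Re z * ln n) * f / a) with (K * f * (6 / a))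
      by (unfold K; field; lra).
    apply Rmult_le_compat_l; [apply Rmult_le_pos; lra|].
    replace (a / n) with (/ a) by (rewrite <- Haa; field; lra).
    assert (/ a * / n <= / a).
    { rewrite <- (Rmult_1_r (/ a)) at 2. apply Rmult_le_compat_l.
      - apply Rlt_le, Rinv_0_lt_compat, Ha.
      - rewrite <- Rinv_1. apply Rinv_le_contravar; lra. }
    lra.
Qed.

(** * Cauchy's theorem for the contour, in polar coordinates *)

Definition Hankel_kernel (s : C) (r theta : R) : C :=
  (Cexp (polar r theta) * polar_power r theta (- s))%C.

Definition ray_integrand (s : C) (r theta : R) : C :=
  (Hankel_kernel s r theta * Cexp (Ci * theta))%C.

Definition arc_integrand (s : C) (r theta : R) : C :=
  (Hankel_kernel s r theta * (Ci * polar r theta))%C.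

Definition arc_integral (s : C) (a b r : R) : C :=
  RInt (V := C_R_CompleteNormedModule) (arc_integrand s r) a b.

Lemma Cmod_Cexp_Ci (theta : R) : Cmod (Cexp (Ci * theta)) = 1.
Proof.
  rewrite Cmod_Cexp. replace (Re (Ci * theta)) with 0; [apply exp_0|].
  unfold Re; simpl; ring.
Qed.

Lemma Re_polar (r theta : R) : Re (polar r theta) = r * cos theta.
Proof.
  unfold polar, Cexp, Re, Im; simpl.
  replace (0 * theta - 1 * 0) with 0 by ring.
  replace (0 * 0 + 1 * theta) with theta by ring. rewrite exp_0. ring.
Qed.

Lemma Cmod_Hankel_kernel (s : C) (r theta : R) :
  Cmod (Hankel_kernel s r theta) = exp (r * cos theta - Re s * ln r + Im s * theta).
Proof.
  unfold Hankel_kernel, polar_power. rewrite Cmod_mult, !Cmod_Cexp, <- exp_plus, Re_polar.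
  f_equal. unfold Re, Im; simpl. ring.
Qed.

Lemma Cmod_ray_integrand (s : C) (r theta : R) :
  Cmod (ray_integrand s r theta) = exp (r * cos theta - Re s * ln r + Im s * theta).
Proof.
  unfold ray_integrand. rewrite Cmod_mult, Cmod_Hankel_kernel, Cmod_Cexp_Ci. ring.
Qed.

Lemma Cmod_arc_integrand (s : C) (r theta : R) : 0 < r ->
  Cmod (arc_integrand s r theta) =
  exp (r * cos theta + (1 - Re s) * ln r + Im s * theta).
Proof.
  intros Hr. unfold arc_integrand, polar.
  rewrite !Cmod_mult, Cmod_Hankel_kernel, Cmod_Cexp_Ci, Cmod_R, Rabs_pos_eq by lra.
  replace (Cmod Ci) with 1.
  - replace (r * cos theta + (1 - Re s) * ln r + Im s * theta) with
      (r * cos theta - Re s * ln r + Im s * theta + ln r) by ring.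
    rewrite (exp_plus _ (ln r)), exp_ln by exact Hr. ring.
  - symmetry. apply Cmod_Ci.
Qed.

Lemma is_derive_RtoC_id (x : R) : is_derive_C RtoC x (RtoC 1).
Proof. apply is_derive_RtoC, (is_derive_id x). Qed.

Lemma is_derive_polar_r (r theta : R) :
  is_derive_C (fun r => polar r theta) r (Cexp (Ci * theta)).
Proof.
  evar_last.
  - apply is_derive_Cmult; [apply is_derive_RtoC_id | apply is_derive_Cconst].
  - eq_in_C. ring.
Qed.

Lemma is_derive_Cexp_Ci (theta : R) :
  is_derive_C (fun theta => Cexp (Ci * theta)) theta (Ci * Cexp (Ci * theta))%C.
Proof.
  evar_last.
  - apply is_derive_Cexp, is_derive_Cmult; [apply is_derive_Cconst|].
    apply is_derive_RtoC_id.
  - eq_in_C. ring.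
Qed.

Lemma is_derive_polar_theta (r theta : R) :
  is_derive_C (fun theta => polar r theta) theta (Ci * polar r theta)%C.
Proof.
  evar_last.
  - apply is_derive_Cmult; [apply is_derive_Cconst | apply is_derive_Cexp_Ci].
  - eq_in_C. unfold polar. ring.
Qed.

Lemma is_derive_Hankel_kernel_r (s : C) (r theta : R) : 0 < r ->
  is_derive_C (fun r => Hankel_kernel s r theta) r
    (Hankel_kernel s r theta * (Cexp (Ci * theta) - s * (/ r)%R))%C.
Proof.
  intros Hr. evar_last.
  - apply is_derive_Cmult; apply is_derive_Cexp; [apply is_derive_polar_r|].
    apply is_derive_Cmult; [apply is_derive_Cconst|].
    apply is_derive_Cplus; [apply is_derive_RtoC, is_derive_ln, Hr | apply is_derive_Cconst].
  - eq_in_C. unfold Hankel_kernel, polar_power. ring.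
Qed.

Lemma is_derive_Hankel_kernel_theta (s : C) (r theta : R) :
  is_derive_C (fun theta => Hankel_kernel s r theta) theta
    (Hankel_kernel s r theta * (Ci * polar r theta - s * Ci))%C.
Proof.
  evar_last.
  - apply is_derive_Cmult; apply is_derive_Cexp; [apply is_derive_polar_theta|].
    apply is_derive_Cmult; [apply is_derive_Cconst|].
    apply is_derive_Cplus; [apply is_derive_Cconst|].
    apply is_derive_Cmult; [apply is_derive_Cconst | apply is_derive_RtoC_id].
  - eq_in_C. unfold Hankel_kernel, polar_power. ring.
Qed.

(** The common value of the derivative of the arc integrand in [r] and of the ray
   integrand in [theta], that is, the Cauchy-Riemann equation in polar
   coordinates. *)
Definition Hankel_kernel_mixed (s : C) (r theta : R) : C :=
  (Hankel_kernel s r theta * (Ci * polar r theta - s * Ci + Ci) * Cexp (Ci * theta))%C.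

Lemma is_derive_arc_integrand_r (s : C) (r theta : R) : 0 < r ->
  is_derive_C (fun r => arc_integrand s r theta) r (Hankel_kernel_mixed s r theta).
Proof.
  intros Hr. evar_last.
  - apply is_derive_Cmult; [apply is_derive_Hankel_kernel_r, Hr|].
    apply is_derive_Cmult; [apply is_derive_Cconst | apply is_derive_polar_r].
  - eq_in_C. unfold Hankel_kernel_mixed, polar. rewrite RtoC_inv by lra. field.
    intros H. apply RtoC_inj in H. lra.
Qed.

Lemma is_derive_ray_integrand_theta (s : C) (r theta : R) :
  is_derive_C (fun theta => ray_integrand s r theta) theta (Hankel_kernel_mixed s r theta).
Proof.
  evar_last.
  - apply is_derive_Cmult; [apply is_derive_Hankel_kernel_theta | apply is_derive_Cexp_Ci].
  - eq_in_C. unfold Hankel_kernel_mixed. ring.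
Qed.

Lemma continuous_Cexp_Ci_comp {U : UniformSpace} (h : U -> R) (x : U) :
  continuous h x -> continuous (fun p => Cexp (Ci * h p)) x.
Proof.
  intros H. apply continuous_Cexp, continuous_Cmult; [apply continuous_const|].
  now apply continuous_RtoC.
Qed.

Lemma continuous_polar {U : UniformSpace} (g h : U -> R) (x : U) :
  continuous g x -> continuous h x -> continuous (fun p => polar (g p) (h p)) x.
Proof.
  intros Hg Hh. apply continuous_Cmult; [now apply continuous_RtoC|].
  now apply continuous_Cexp_Ci_comp.
Qed.

Lemma continuous_Hankel_kernel {U : UniformSpace} (s : C) (g h : U -> R) (x : U) :
  0 < g x -> continuous g x -> continuous h x ->
  continuous (fun p => Hankel_kernel s (g p) (h p)) x.
Proof.
  intros Hx Hg Hh. apply continuous_Cmult; apply continuous_Cexp.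
  - now apply continuous_polar.
  - apply continuous_Cmult; [apply continuous_const|].
    apply continuous_Cplus.
    + apply continuous_RtoC. apply (continuous_comp g ln); [exact Hg | now apply continuous_ln].
    + apply continuous_Cmult; [apply continuous_const | now apply continuous_RtoC].
Qed.

Lemma continuous_Hankel_kernel_mixed {U : UniformSpace} (s : C) (g h : U -> R) (x : U) :
  0 < g x -> continuous g x -> continuous h x ->
  continuous (fun p => Hankel_kernel_mixed s (g p) (h p)) x.
Proof.
  intros Hx Hg Hh. apply continuous_Cmult; [|now apply continuous_Cexp_Ci_comp].
  apply continuous_Cmult; [now apply continuous_Hankel_kernel|].
  apply continuous_Cplus; [apply continuous_Cplus|]; try apply continuous_const.
  apply continuous_Cmult; [apply continuous_const | now apply continuous_polar].
Qed.

Lemma continuous_ray_integrand_r (s : C) (r theta : R) : 0 < r ->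
  continuous (fun r => ray_integrand s r theta) r.
Proof.
  intros Hr. apply continuous_Cmult; [|apply continuous_const].
  apply (continuous_Hankel_kernel s (fun r => r) (fun _ => theta));
    [exact Hr | apply continuous_id | apply continuous_const].
Qed.

Lemma continuous_arc_integrand_theta (s : C) (r theta : R) : 0 < r ->
  continuous (arc_integrand s r) theta.
Proof.
  intros Hr. apply continuous_Cmult.
  - apply (continuous_Hankel_kernel s (fun _ => r) (fun t => t));
      [exact Hr | apply continuous_const | apply continuous_id].
  - apply continuous_Cmult; [apply continuous_const|].
    apply (continuous_polar (fun _ => r) (fun t => t)); [apply continuous_const | apply continuous_id].
Qed.

Lemma arc_integral_correct (s : C) (a b r : R) : 0 < r ->
  is_RInt (V := C_R_NormedModule) (arc_integrand s r) a b (arc_integral s a b r).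
Proof.
  intros Hr. apply (RInt_correct (V := C_R_CompleteNormedModule)).
  apply (ex_RInt_continuous (V := C_R_CompleteNormedModule)). intros t _.
  now apply continuous_arc_integrand_theta.
Qed.

Lemma locally_pos (r : R) : 0 < r -> locally r (fun y => 0 < y).
Proof.
  intros Hr. exists (mkposreal r Hr). intros y Hy.
  change (Rabs (y - r) < r) in Hy. apply Rabs_def2 in Hy. lra.
Qed.

(** Cauchy's theorem in differential form. Differentiating under the integral sign
   gives the integral in [theta] of the mixed derivative, whose primitive is the ray
   integrand. *)
Lemma is_derive_arc_integral (s : C) (a b r : R) : 0 < r ->
  is_derive_C (arc_integral s a b) r (ray_integrand s r b - ray_integrand s r a)%C.
Proof.
  intros Hr.
  assert (E : RInt (V := C_R_CompleteNormedModule) (Hankel_kernel_mixed s r) a b =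
    (ray_integrand s r b - ray_integrand s r a)%C).
  { apply (is_RInt_unique (V := C_R_CompleteNormedModule)).
    apply (is_RInt_derive (V := C_R_CompleteNormedModule) (ray_integrand s r)).
    - intros t _. apply is_derive_ray_integrand_theta.
    - intros t _. apply (continuous_Hankel_kernel_mixed s (fun _ => r) (fun t => t));
        [exact Hr | apply continuous_const | apply continuous_id]. }
  rewrite <- E. apply is_derive_RInt_param_C.
  - generalize (locally_pos r Hr); apply filter_imp. intros y Hy t.
    now apply is_derive_arc_integrand_r.
  - intros t. apply continuous_Hankel_kernel_mixed;
      [exact Hr | apply continuous_fst | apply continuous_snd].
  - generalize (locally_pos r Hr); apply filter_imp. intros y Hy t.
    now apply continuous_arc_integrand_theta.
Qed.

Lemma is_RInt_ray_difference (s : C) (a b r1 r2 : R) : 0 < r1 -> 0 < r2 ->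
  is_RInt (V := C_R_NormedModule) (fun r => ray_integrand s r b - ray_integrand s r a)%C
    r1 r2 (arc_integral s a b r2 - arc_integral s a b r1)%C.
Proof.
  intros H1 H2.
  assert (Hpos : forall t, Rmin r1 r2 <= t <= Rmax r1 r2 -> 0 < t).
  { intros t [Ht _]. apply Rlt_le_trans with (2 := Ht). now apply Rmin_glb_lt. }
  apply (is_RInt_derive (V := C_R_CompleteNormedModule) (arc_integral s a b)).
  - intros t Ht. apply is_derive_arc_integral. auto.
  - intros t Ht. apply (continuous_minus (V := C_R_NormedModule));
      apply continuous_ray_integrand_r; auto.
Qed.

(** The modulus of the integrand is [r^(-Re s) e^(r cos theta)] up to a constant,
   and the power is eventually absorbed by half of the exponential. *)
Lemma ex_ray_integral (s : C) (eps theta : R) : 0 < eps -> cos theta < 0 ->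
  exists l, is_RInt_gen (V := C_R_NormedModule) (fun r => ray_integrand s r theta)
    (at_point eps) (Rbar_locally p_infty) l.
Proof.
  intros He Hc.
  (* Beyond [M] the power is at most [e^(k r)] with [k] half of the decay rate,
     which leaves [e^(- k r)]. *)
  destruct (ln_le_linear (- Re s) (- cos theta / 2)) as [M [HM HMx]]; [lra|].
  set (x0 := M + 1). set (k := - cos theta / 2). set (B := exp (Im s * theta)).
  assert (Hk : 0 < k) by (unfold k; lra).
  assert (Hx0 : M < x0) by (unfold x0; lra).
  assert (Hray : forall x, 0 < x -> continuous (fun r => ray_integrand s r theta) x)
    by (intros; now apply continuous_ray_integrand_r).
  assert (H1 : is_RInt_gen (V := C_R_NormedModule) (fun r => ray_integrand s r theta)
    (at_point eps) (at_point x0)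
    (RInt (V := C_R_CompleteNormedModule) (fun r => ray_integrand s r theta) eps x0)).
  { apply is_RInt_gen_at_point. apply (RInt_correct (V := C_R_CompleteNormedModule)).
    apply (ex_RInt_continuous (V := C_R_CompleteNormedModule)). intros t [Ht _].
    apply Hray. apply Rlt_le_trans with (2 := Ht). apply Rmin_glb_lt; lra. }
  destruct (ex_RInt_gen_dominated (V := C_R_CompleteNormedModule)
    (at_point x0) (Rbar_locally p_infty) (fun x => M < x)
    (fun r => ray_integrand s r theta) (fun x => B * exp (- (k * x)))
    (minus 0 (B * - (exp (- (k * x0)) / k)))) as [l Hl].
  - intros x y z Hx Hy Hz. lra.
  - exact Hx0.
  - now exists M.
  - intros x Hx. apply Hray. lra.
  - intros x Hx. apply (ex_derive_continuous (V := R_NormedModule)). auto_derive; trivial.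
  - intros x Hx. apply Rle_trans with (1 := Req_le _ _ (norm_C _)).
    rewrite Cmod_ray_integrand. unfold B. rewrite <- exp_plus. apply exp_le.
    specialize (HMx x Hx). unfold k. lra.
  - apply (is_RInt_gen_of_derive (V := R_CompleteNormedModule)
      (at_point x0) (Rbar_locally p_infty)) with
      (D := fun x => M < x) (f := fun x => B * - (exp (- (k * x)) / k)).
    + intros x y z Hx Hy Hz. lra.
    + exact Hx0.
    + now exists M.
    + intros x Hx. auto_derive; [trivial|]. field. lra.
    + intros x Hx. apply (ex_derive_continuous (V := R_NormedModule)). auto_derive; trivial.
    + intros P HP. exact (locally_singleton _ _ HP).
    + assert (Hlim := power_exp_lim_infty 0 k Hk).
      assert (H := filterlim_comp _ _ _ _ _ _ _ _ Hlim
        (filterlim_scal_r (V := R_NormedModule) (- B / k) 0)).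
      rewrite (scal_zero_r (V := R_NormedModule)) in H.
      eapply filterlim_ext; [|exact H].
      intros x; simpl. unfold scal; simpl. unfold mult; simpl.
      replace (0 * ln x - k * x) with (- (k * x)) by ring. field. lra.
  - eexists. apply (is_RInt_gen_Chasles (V := C_R_NormedModule)) with (1 := H1) (2 := Hl).
Qed.

Lemma is_RInt_gen_filterlim (f : R -> C) (a : R) (F : (R -> Prop) -> Prop) {FF : Filter F} (l : C) :
  is_RInt_gen (V := C_R_NormedModule) f (at_point a) F l ->
  filterlim (RInt (V := C_R_CompleteNormedModule) f a) F (locally l).
Proof.
  intros H P HP. destruct (H P HP) as [Q R' HQ HR HQR].
  unfold filtermap. revert HR. apply filter_imp. intros x Hx.
  destruct (HQR a x HQ Hx) as [y [Hy1 Hy2]]; simpl in Hy1.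
  rewrite (is_RInt_unique (V := C_R_CompleteNormedModule) _ _ _ _ Hy1). exact Hy2.
Qed.

Definition arc_limit (s : C) (a b : R) (I : C) : Prop :=
  filterlim (arc_integral s a b) (Rbar_locally p_infty) (locally I).

(** By the differential form of Cauchy's theorem, the arc of radius [x] equals the
   arc of radius [eps] plus the two ray integrals between [eps] and [x], oriented as
   in the contour; the limit of this sum is the contour integral. *)
Lemma contour_integral_arc_limit (s : C) (eps psi delta1 delta2 : R) :
  0 < eps -> cos (- delta1 + psi) < 0 -> cos (delta2 + psi) < 0 ->
  exists I, is_gamma_contour_integral (Hankel_kernel s) eps psi delta1 delta2 I /\
    arc_limit s (- delta1 + psi) (delta2 + psi) I.
Proof.
  intros He H1 H2.
  set (a := - delta1 + psi) in *. set (b := delta2 + psi) in *.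
  destruct (ex_ray_integral s eps a He H1) as [la Ha].
  destruct (ex_ray_integral s eps b He H2) as [lb Hb].
  exists (- la + arc_integral s a b eps + lb)%C. split.
  - exists (- la)%C, (arc_integral s a b eps), lb. split; [|split; [|split]].
    + apply (is_RInt_gen_swap (V := C_R_NormedModule) (Fa := Rbar_locally p_infty) (Fb := at_point eps)
         _ la). exact Ha.
    + now apply arc_integral_correct.
    + exact Hb.
    + reflexivity.
  - unfold arc_limit.
    assert (La := is_RInt_gen_filterlim _ _ _ _ Ha).
    assert (Lb := is_RInt_gen_filterlim _ _ _ _ Hb).
    assert (Lm : filterlim (fun x =>
        (arc_integral s a b eps + (RInt (V := C_R_CompleteNormedModule) (fun r => ray_integrand s r b) eps x
        - RInt (V := C_R_CompleteNormedModule) (fun r => ray_integrand s r a) eps x))%C)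
        (Rbar_locally p_infty) (locally (arc_integral s a b eps + (lb - la))%C)).
    { apply (filterlim_comp_2 (G := locally (arc_integral s a b eps)) (H := locally (lb - la)%C)
        (fun _ => arc_integral s a b eps) _ (@plus C_R_NormedModule)).
      - apply filterlim_const.
      - apply (filterlim_comp_2 (G := locally lb) (H := locally (- la)%C) 
         _ (fun x => - RInt (V := C_R_CompleteNormedModule) (fun r => ray_integrand s r a) eps x)%C
         (@plus C_R_NormedModule)).
        + exact Lb.
        + eapply filterlim_comp; [exact La|]. apply (filterlim_opp (V := C_R_NormedModule)).
        + apply (filterlim_plus (V := C_R_NormedModule)).
      - apply (filterlim_plus (V := C_R_NormedModule)). }
    replace (- la + arc_integral s a b eps + lb)%C with
      (arc_integral s a b eps + (lb - la))%C by ring.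
    apply filterlim_ext_loc with (2 := Lm).
    exists 0. intros x Hx.
    assert (HI : forall t, ex_RInt (V := C_R_NormedModule) (fun r => ray_integrand s r t) eps x).
    { intros t. apply (ex_RInt_continuous (V := C_R_CompleteNormedModule)). intros u [Hu _].
      apply continuous_ray_integrand_r.
      apply Rlt_le_trans with (2 := Hu). apply Rmin_glb_lt; lra. }
    assert (E := is_RInt_minus (V := C_R_NormedModule) _ _ _ _ _ _
      (RInt_correct (V := C_R_CompleteNormedModule) _ _ _ (HI b))
      (RInt_correct (V := C_R_CompleteNormedModule) _ _ _ (HI a))).
    apply (is_RInt_unique (V := C_R_CompleteNormedModule)) in E.
    assert (E2 := is_RInt_ray_difference s a b eps x He Hx).
    apply (is_RInt_unique (V := C_R_CompleteNormedModule)) in E2.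
    assert (E3 : (RInt (V := C_R_CompleteNormedModule) (fun r => ray_integrand s r b) eps x
        - RInt (V := C_R_CompleteNormedModule) (fun r => ray_integrand s r a) eps x
        = arc_integral s a b x - arc_integral s a b eps)%C).
    { transitivity (RInt (V := C_R_CompleteNormedModule)
         (fun r => ray_integrand s r b - ray_integrand s r a)%C eps x); [symmetry; exact E | exact E2]. }
    rewrite E3. ring.
Qed.

(** * Limits of integrals over growing arcs *)

Lemma filterlim_C_squeeze (f : R -> C) (l : C) (h : R -> R) (F : (R -> Prop) -> Prop) {FF : Filter F} :
  F (fun x => Cmod (f x - l) <= h x) -> filterlim h F (locally 0) -> filterlim f F (locally l).
Proof.
  intros Hfh Hh. apply filterlim_Cmod; [exact FF|].
  apply filterlim_locally. intros e.
  generalize (filter_and _ _ Hfh (proj1 (filterlim_locally _ _) Hh e)).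
  apply filter_imp. intros x [H1 H2].
  change (Rabs (h x - 0) < e) in H2. change (Rabs (Cmod (f x - l) - 0) < e).
  rewrite Rminus_0_r in *. rewrite Rabs_pos_eq by apply Cmod_ge_0.
  apply Rle_lt_trans with (1 := H1). apply Rle_lt_trans with (1 := Rle_abs _) (2 := H2).
Qed.

Lemma filterlim_scal_0 (c : R) (h : R -> R) (F : (R -> Prop) -> Prop) {FF : Filter F} :
  filterlim h F (locally 0) -> filterlim (fun x => c * h x) F (locally 0).
Proof.
  intros H.
  assert (H2 := filterlim_comp _ _ _ _ _ _ _ _ H (filterlim_scal_r (V := R_NormedModule) c 0)).
  rewrite (scal_zero_r (V := R_NormedModule)) in H2. exact H2.
Qed.

Lemma Rabs_le_between (a b t : R) : Rmin a b <= t <= Rmax a b -> Rabs t <= Rabs a + Rabs b.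
Proof.
  unfold Rmin, Rmax, Rabs. destruct (Rle_dec a b); repeat destruct Rcase_abs; lra.
Qed.

(** The length of the arc and the modulus of [t^(-s)] grow at most like powers of [r],
   which are no match for the factor [e^(-c r)]. *)
Lemma arc_integral_vanish (s : C) (a b c : R) : 0 < c ->
  (forall t, Rmin a b <= t <= Rmax a b -> cos t <= - c) -> arc_limit s a b 0.
Proof.
  intros Hc Hcos.
  set (T := Rabs (Im s) * (Rabs a + Rabs b)).
  apply filterlim_C_squeeze with
    (h := fun r => (Rabs (b - a) * exp T) * exp ((1 - Re s) * ln r - c * r)).
  - exact _.
  - exists 0. intros r Hr. replace (arc_integral s a b r - 0)%C with (arc_integral s a b r) by ring.
    rewrite <- norm_C, Rmult_assoc.
    refine (norm_RInt_le_const_abs (V := C_R_NormedModule) _ _ _ _ _ _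
      (arc_integral_correct s a b r Hr)).
    intros t Ht. rewrite norm_C, Cmod_arc_integrand by exact Hr.
    rewrite <- exp_plus. apply exp_le.
    assert (r * cos t <= r * - c) by (apply Rmult_le_compat_l; [lra | auto]).
    assert (Im s * t <= T).
    { apply Rle_trans with (1 := Rle_abs _). rewrite Rabs_mult.
      apply Rmult_le_compat_l; [apply Rabs_pos | now apply Rabs_le_between]. }
    lra.
  - apply filterlim_scal_0; [exact _|]. now apply power_exp_lim_infty.
Qed.

Lemma cos_le_abs (x y : R) : Rabs x <= Rabs y -> Rabs y <= PI -> cos y <= cos x.
Proof.
  intros H1 H2.
  assert (E : forall u, cos u = cos (Rabs u)).
  { intros u. unfold Rabs. destruct Rcase_abs; [now rewrite cos_neg | reflexivity]. }
  rewrite (E x), (E y). assert (Hx := Rabs_pos x).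
  apply cos_decr_1; lra.
Qed.

Lemma arc_integral_Chasles (s : C) (a b c r : R) : 0 < r ->
  arc_integral s a c r = (arc_integral s a b r + arc_integral s b c r)%C.
Proof.
  intros Hr. symmetry.
  apply (RInt_Chasles (V := C_R_CompleteNormedModule) (arc_integrand s r));
    eexists; now apply arc_integral_correct.
Qed.

Lemma arc_limit_Chasles (s : C) (a b c : R) (I J : C) :
  arc_limit s a b I -> arc_limit s b c J -> arc_limit s a c (I + J)%C.
Proof.
  intros HI HJ.
  apply filterlim_ext_loc with (fun r => @plus C_R_NormedModule (arc_integral s a b r) (arc_integral s b c r)).
  - exists 0. intros r Hr. symmetry. now apply arc_integral_Chasles.
  - eapply filterlim_comp_2; [exact HI | exact HJ | apply (filterlim_plus (V := C_R_NormedModule))].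
Qed.

Lemma arc_limit_unique (s : C) (a b : R) (I J : C) :
  arc_limit s a b I -> arc_limit s a b J -> I = J.
Proof.
  intros HI HJ.
  exact (filterlim_locally_unique (V := C_R_NormedModule) _ I J HI HJ).
Qed.

(** The arcs between [a] and [-pi] and between [b] and [pi] lie in the open left
   half-plane, because [a] and [b] differ by less than a right angle from [-pi] and
   [pi]. *)
Lemma arc_limit_full_circle (s : C) (a b : R) (I : C) :
  - (3 * (PI / 2)) < a < - (PI / 2) -> PI / 2 < b < 3 * (PI / 2) ->
  arc_limit s a b I -> arc_limit s (- PI) PI I.
Proof.
  intros Ha Hb H.
  assert (HPI := PI_RGT_0).
  assert (Habs : forall u v : R, Rmin 0 v <= u <= Rmax 0 v -> Rabs u <= Rabs v).
  { intros u v. unfold Rmin, Rmax, Rabs.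
    destruct (Rle_dec 0 v); repeat destruct Rcase_abs; lra. }
  assert (H1 : arc_limit s (- PI) a 0).
  { apply arc_integral_vanish with (c := cos (a + PI)).
    - apply cos_gt_0; lra.
    - intros t Ht. replace (cos t) with (- cos (t + PI)) by (rewrite neg_cos; ring).
      apply Ropp_le_contravar, cos_le_abs.
      + apply Habs. revert Ht. unfold Rmin, Rmax.
        destruct (Rle_dec (- PI) a), (Rle_dec 0 (a + PI)); lra.
      + apply Rabs_le; lra. }
  assert (H2 : arc_limit s b PI 0).
  { apply arc_integral_vanish with (c := cos (b - PI)).
    - apply cos_gt_0; lra.
    - intros t Ht. replace (cos t) with (- cos (t - PI)).
      2: { replace (cos t) with (cos ((t - PI) + PI)) by (f_equal; ring). rewrite neg_cos; ring. }
      apply Ropp_le_contravar, cos_le_abs.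
      + apply Habs. revert Ht. unfold Rmin, Rmax.
        destruct (Rle_dec b PI), (Rle_dec 0 (b - PI)); lra.
      + apply Rabs_le; lra. }
  replace I with (0 + I + 0)%C by ring.
  apply (arc_limit_Chasles s (- PI) b PI); [|exact H2].
  now apply (arc_limit_Chasles s (- PI) a b).
Qed.

Lemma polar_exp_ln (r theta : R) : 0 < r -> polar r theta = Cexp (ln r + Ci * theta)%C.
Proof.
  intros Hr. unfold polar. now rewrite Cexp_plus, Cexp_RtoC, exp_ln.
Qed.

Lemma Hankel_kernel_plus_polar (s : C) (r theta : R) : 0 < r ->
  (Hankel_kernel (s + 1) r theta * polar r theta = Hankel_kernel s r theta)%C.
Proof.
  intros Hr. unfold Hankel_kernel, polar_power.
  rewrite (polar_exp_ln r theta Hr) at 2. rewrite <- Cmult_assoc, <- Cexp_plus.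
  f_equal. f_equal. ring.
Qed.

(** Integration by parts along the arc: [exp t * t^(-s)] has the derivative [exp t *
   t^(-s) - s exp t * t^(-s-1)]. *)
Lemma arc_integral_rec (s : C) (a b r : R) : 0 < r ->
  (arc_integral s a b r = s * arc_integral (s + 1) a b r
     + (Hankel_kernel s r b - Hankel_kernel s r a))%C.
Proof.
  intros Hr.
  assert (H1 : is_RInt (V := C_R_NormedModule)
     (fun t => arc_integrand s r t - s * arc_integrand (s + 1) r t)%C a b
     (Hankel_kernel s r b - Hankel_kernel s r a)%C).
  { apply (is_RInt_ext (V := C_R_NormedModule)
      (fun t => Hankel_kernel s r t * (Ci * polar r t - s * Ci))%C).
    { intros t _. unfold arc_integrand.
      replace (Hankel_kernel (s + 1) r t * (Ci * polar r t))%C with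
        (Ci * (Hankel_kernel (s + 1) r t * polar r t))%C by ring.
      rewrite Hankel_kernel_plus_polar by exact Hr. eq_in_C. ring. }
    apply (is_RInt_derive (V := C_R_CompleteNormedModule) (Hankel_kernel s r)).
    - intros t _. apply is_derive_Hankel_kernel_theta.
    - intros t _. apply continuous_Cmult.
      + apply (continuous_Hankel_kernel s (fun _ => r) (fun t => t));
          [exact Hr | apply continuous_const | apply continuous_id].
      + apply continuous_Cplus; [|apply continuous_const].
        apply continuous_Cmult; [apply continuous_const|].
        apply (continuous_polar (fun _ => r) (fun t => t)); [apply continuous_const | apply continuous_id]. }
  assert (H2 := is_RInt_minus (V := C_R_NormedModule) _ _ _ _ _ _
    (arc_integral_correct s a b r Hr)
    (is_RInt_Cmult_l s _ _ _ _ (arc_integral_correct (s + 1) a b r Hr))).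
  apply (is_RInt_unique (V := C_R_CompleteNormedModule)) in H1.
  apply (is_RInt_unique (V := C_R_CompleteNormedModule)) in H2.
  assert (E : (Hankel_kernel s r b - Hankel_kernel s r a =
    arc_integral s a b r - s * arc_integral (s + 1) a b r)%C).
  { rewrite <- H1. exact H2. }
  rewrite E. ring.
Qed.

Lemma Hankel_kernel_lim (s : C) (theta : R) : cos theta < 0 ->
  filterlim (fun r => Hankel_kernel s r theta) (Rbar_locally p_infty) (locally (RtoC 0)).
Proof.
  intros Hc.
  apply filterlim_C_squeeze with
    (h := fun r => exp (Im s * theta) * exp (- Re s * ln r - (- cos theta) * r)).
  - exact _.
  - apply filter_forall. intros r. 
    replace (Hankel_kernel s r theta - 0)%C with (Hankel_kernel s r theta) by ring.
    rewrite Cmod_Hankel_kernel, <- exp_plus. apply exp_le. lra.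
  - apply filterlim_scal_0; [exact _|]. apply power_exp_lim_infty. lra.
Qed.

Lemma filterlim_Cmult_l (c l : C) (f : R -> C) (F : (R -> Prop) -> Prop) {FF : Filter F} :
  filterlim f F (locally l) -> filterlim (fun x => c * f x)%C F (locally (c * l)%C).
Proof.
  intros H.
  assert (Hc : continuous (fun z : C => c * z)%C l).
  { apply continuous_Cmult; [apply continuous_const | apply continuous_id]. }
  exact (filterlim_comp _ _ _ _ _ _ _ _ H Hc).
Qed.

Lemma filterlim_Cplus (f g : R -> C) (l m : C) (F : (R -> Prop) -> Prop) {FF : Filter F} :
  filterlim f F (locally l) -> filterlim g F (locally m) ->
  filterlim (fun x => f x + g x)%C F (locally (l + m)%C).
Proof.
  intros Hf Hg.
  exact (filterlim_comp_2 f g (@plus C_R_NormedModule) Hf Hg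
    (filterlim_plus (V := C_R_NormedModule) l m)).
Qed.

Lemma arc_limit_rec (s : C) (a b : R) (I : C) : cos a < 0 -> cos b < 0 ->
  arc_limit (s + 1) a b I -> arc_limit s a b (s * I)%C.
Proof.
  intros Ha Hb H.
  apply filterlim_ext_loc with (fun r => s * arc_integral (s + 1) a b r
     + (Hankel_kernel s r b + (- (1)) * Hankel_kernel s r a))%C.
  { exists 0. intros r Hr. rewrite (arc_integral_rec s a b r Hr). eq_in_C. ring. }
  replace (s * I)%C with (s * I + (0 + (- (1)) * 0))%C by ring.
  repeat (apply filterlim_Cplus; [exact _ | | ]).
  - apply filterlim_Cmult_l; [exact _ | exact H].
  - now apply Hankel_kernel_lim.
  - apply filterlim_Cmult_l; [exact _|]. now apply Hankel_kernel_lim.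
Qed.

(** * Circles at integer exponents, and two numerical bounds *)

Lemma polar_PI (r : R) : polar r (- PI) = polar r PI.
Proof.
  unfold polar. f_equal. unfold Cexp.
  replace (Im (Ci * RtoC (- PI))) with (- PI) by (unfold Im; simpl; ring).
  replace (Im (Ci * RtoC PI)) with PI by (unfold Im; simpl; ring).
  replace (Re (Ci * RtoC (- PI))) with 0 by (unfold Re; simpl; ring).
  replace (Re (Ci * RtoC PI)) with 0 by (unfold Re; simpl; ring).
  rewrite cos_neg, sin_neg, sin_PI, Ropp_0. reflexivity.
Qed.

Lemma Cexp_Ci_PI : Cexp (Ci * (- PI)%R) = Cexp (Ci * PI).
Proof.
  generalize (polar_PI 1). unfold polar. rewrite !Cmult_1_l. auto.
Qed.

Lemma polar_neq_0 (r theta : R) : 0 < r -> polar r theta <> 0%C.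
Proof. intros Hr. rewrite polar_exp_ln by exact Hr. apply Cexp_neq_0. Qed.

Lemma Hankel_kernel_0 (r theta : R) : Hankel_kernel 0 r theta = Cexp (polar r theta).
Proof.
  unfold Hankel_kernel, polar_power.
  replace (- (0) * (ln r + Ci * theta))%C with (RtoC 0) by ring.
  rewrite Cexp_0. ring.
Qed.

(** An integer power of [t] takes the same value on the two banks of the cut. *)
Lemma Hankel_kernel_nat_periodic (n : nat) (r : R) : 0 < r ->
  Hankel_kernel (INR n) r (- PI) = Hankel_kernel (INR n) r PI.
Proof.
  intros Hr. induction n as [|n IH].
  - simpl INR. now rewrite !Hankel_kernel_0, polar_PI.
  - assert (HP := polar_neq_0 r PI Hr).
    assert (E1 := Hankel_kernel_plus_polar (INR n) r PI Hr).
    assert (E2 := Hankel_kernel_plus_polar (INR n) r (- PI) Hr).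
    rewrite polar_PI, IH, <- E1 in E2.
    rewrite S_INR, RtoC_plus.
    replace (Hankel_kernel (INR n + 1) r PI) with
      (Hankel_kernel (INR n + 1) r PI * polar r PI / polar r PI)%C by (field; exact HP).
    rewrite <- E2. field. exact HP.
Qed.

(** The integral of [exp t / t] over a circle. The factor [1 / t] cancels against
   [dt], which leaves [i exp (r e^(i theta))]; this is smooth down to [r = 0], its
   derivative in [r] has a periodic primitive in [theta], so that the integral does
   not depend on [r], and at [r = 0] it is the constant [i]. *)
Lemma arc_integral_1 (r : R) : 0 < r -> arc_integral 1 (- PI) PI r = (2 * PI * Ci)%C.
Proof.
  intros Hr.
  (* [A] extends the arc integral to [u <= 0], so that it can be differentiated
     across 0 and evaluated there. *)
  pose (A := fun u => RInt (V := C_R_CompleteNormedModule)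
    (fun t => (Ci * Cexp (polar u t))%C) (- PI) PI).
  pose (dA := fun u t : R => (Ci * (Cexp (Ci * t) * Cexp (polar u t)))%C).
  assert (HdA : forall u, RInt (V := C_R_CompleteNormedModule) (dA u) (- PI) PI = RtoC 0).
  { intros u. apply (is_RInt_unique (V := C_R_CompleteNormedModule)).
    assert (Hcont : forall t, continuous (dA u) t).
    { intros t. apply continuous_Cmult; [apply continuous_const|].
      apply continuous_Cmult; [apply (continuous_Cexp_Ci_comp (fun t => t)), continuous_id|].
      apply continuous_Cexp, (continuous_polar (fun _ => u) (fun t => t));
        [apply continuous_const | apply continuous_id]. }
    (* The primitive [exp (u e^(i t)) / u] breaks down at [u = 0], where the
       integrand is [i e^(i t)]. *)
    destruct (Req_dec u 0) as [Hu | Hu].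
    - replace (RtoC 0) with (@minus C_R_NormedModule (Cexp (Ci * PI)) (Cexp (Ci * (- PI)%R))).
      + apply (is_RInt_derive (V := C_R_CompleteNormedModule) (fun t => Cexp (Ci * t))).
        * intros t _. evar_last; [apply is_derive_Cexp_Ci|]. eq_in_C. unfold dA, polar.
          rewrite Hu. replace (0 * Cexp (Ci * t))%C with (RtoC 0) by ring.
          rewrite Cexp_0. ring.
        * auto.
      + rewrite Cexp_Ci_PI. apply (minus_eq_zero (Cexp (Ci * PI) : C_R_NormedModule)).
    - replace (RtoC 0) with (@minus C_R_NormedModule (Cexp (polar u PI) * (/ u)%R)%C
        (Cexp (polar u (- PI)) * (/ u)%R)%C).
      + apply (is_RInt_derive (V := C_R_CompleteNormedModule)
          (fun t => Cexp (polar u t) * (/ u)%R)%C).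
        * intros t _. evar_last.
          { apply is_derive_Cmult; [apply is_derive_Cexp, is_derive_polar_theta | apply is_derive_Cconst]. }
          eq_in_C. unfold dA, polar. rewrite RtoC_inv by exact Hu. field.
          intros H. apply RtoC_inj in H. contradiction.
        * auto.
      + rewrite polar_PI. apply (minus_eq_zero ((Cexp (polar u PI) * (/ u)%R)%C : C_R_NormedModule)). }
  assert (HA : forall u, is_derive_C A u (RtoC 0)).
  { intros u. rewrite <- (HdA u).
    apply (is_derive_RInt_param_C (fun u t => (Ci * Cexp (polar u t))%C) dA).
    - apply filter_forall. intros v t. evar_last.
      + apply is_derive_Cmult; [apply is_derive_Cconst | apply is_derive_Cexp, is_derive_polar_r].
      + eq_in_C. unfold dA. ring.
    - intros t. apply continuous_Cmult; [apply continuous_const|].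
      apply continuous_Cmult; [apply continuous_Cexp_Ci_comp, continuous_snd|].
      apply continuous_Cexp, continuous_polar; [apply continuous_fst | apply continuous_snd].
    - apply filter_forall. intros v t. apply continuous_Cmult; [apply continuous_const|].
      apply continuous_Cexp, (continuous_polar (fun _ => v) (fun t => t));
        [apply continuous_const | apply continuous_id]. }
  assert (HA0 : A r = A 0).
  { assert (H : is_RInt (V := C_R_NormedModule) (fun _ => RtoC 0) 0 r (@minus C_R_NormedModule (A r) (A 0))).
    { apply (is_RInt_derive (V := C_R_CompleteNormedModule) A).
      - intros t _. apply HA.
      - intros t _. apply continuous_const. }
    apply (is_RInt_unique (V := C_R_CompleteNormedModule)) in H.
    rewrite (RInt_const (V := C_R_CompleteNormedModule)) in H.
    rewrite (scal_zero_r (V := C_R_NormedModule)) in H.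
    change (RtoC 0 = A r - A 0)%C in H.
    replace (A r) with (A r - A 0 + A 0)%C by ring. rewrite <- H. eq_in_C. ring. }
  assert (E : arc_integral 1 (- PI) PI r = A r).
  { apply (RInt_ext (V := C_R_CompleteNormedModule)). intros t _.
    unfold arc_integrand.
    replace (Hankel_kernel 1 r t * (Ci * polar r t))%C with
      (Ci * (Hankel_kernel (0 + 1) r t * polar r t))%C.
    - rewrite Hankel_kernel_plus_polar, Hankel_kernel_0 by exact Hr. reflexivity.
    - replace (0 + 1)%C with (RtoC 1) by ring. ring. }
  rewrite E, HA0. unfold A.
  rewrite (RInt_ext (V := C_R_CompleteNormedModule) _ (fun _ => Ci)).
  - rewrite (RInt_const (V := C_R_CompleteNormedModule)).
    apply C_ext; unfold Re, Im; simpl; unfold scal; simpl; unfold mult; simpl; ring.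
  - intros t _. unfold polar. replace (0 * Cexp (Ci * t))%C with (RtoC 0) by ring.
    rewrite Cexp_0. eq_in_C. ring.
Qed.

(** Exact because the boundary terms of the recurrence cancel for integer
   exponents. *)
Lemma arc_integral_nat (m : nat) (r : R) : 0 < r ->
  (arc_integral (INR (S m)) (- PI) PI r * INR (fact m) = 2 * PI * Ci)%C.
Proof.
  intros Hr. induction m as [|m IH].
  - simpl INR. rewrite arc_integral_1 by exact Hr. ring.
  - rewrite <- IH.
    rewrite (arc_integral_rec (INR (S m)) (- PI) PI r Hr), Hankel_kernel_nat_periodic by exact Hr.
    replace (RtoC (INR (S m)) + 1)%C with (RtoC (INR (S (S m)))) by (now rewrite S_INR, RtoC_plus).
    change (fact (S m)) with (S m * fact m)%nat. rewrite mult_INR, RtoC_mult. ring.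
Qed.

(** From [1 - cos t = 2 sin^2 (t / 2)] and [sin x >= x - x^3 / 6 >= x / 3] on [0,
   2], which contains [0, pi / 2]. Any smaller positive constant would serve as
   well. *)
Lemma cos_le_quadratic (t : R) : Rabs t <= PI -> cos t <= 1 - t ^ 2 / 18.
Proof.
  intros Ht.
  assert (Hs : forall x, 0 <= x <= 2 -> x / 3 <= sin x).
  { intros x Hx. destruct (pre_sin_bound x 0) as [H _]; [lra | lra|].
    apply Rle_trans with (2 := H). unfold sin_approx, sin_term; simpl.
    assert (0 <= x * (4 - x * x)) by (apply Rmult_le_pos; nra). lra. }
  set (x := Rabs t / 2). assert (HP := PI_4). assert (Ha := Rabs_pos t).
  assert (Hx : x / 3 <= sin x) by (apply Hs; unfold x; lra).
  assert (E : cos t = 1 - 2 * sin x * sin x).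
  { rewrite <- cos_2a_sin. replace (2 * x) with (Rabs t) by (unfold x; field).
    unfold Rabs. destruct Rcase_abs; [now rewrite cos_neg | reflexivity]. }
  rewrite E, <- (pow2_abs t). replace (Rabs t) with (2 * x) by (unfold x; field).
  assert (0 <= x) by (unfold x; lra).
  assert ((x / 3) * (x / 3) <= sin x * sin x) by (apply Rmult_le_compat; lra).
  nra.
Qed.

Lemma ln_plus_1_bound (y : R) : 0 <= y -> 2 * y / (2 + y) <= ln (1 + y).
Proof.
  intros Hy.
  assert (Hd : forall x, 0 <= x -> is_derive (fun y => ln (1 + y) - 2 * y / (2 + y)) x
      (x ^ 2 / ((1 + x) * (2 + x) ^ 2))).
  { intros x Hx. auto_derive; [repeat split; lra|]. field. lra. }
  destruct (MVT_gen (fun y => ln (1 + y) - 2 * y / (2 + y)) 0 y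
    (fun x => x ^ 2 / ((1 + x) * (2 + x) ^ 2))) as [c [Hc E]].
  - rewrite Rmin_left, Rmax_right by exact Hy. intros x Hx. apply Hd. lra.
  - rewrite Rmin_left, Rmax_right by exact Hy. intros x Hx.
    refine (derivable_continuous_pt _ _ (ex_derive_Reals_0 _ _ _)).
    eexists. apply Hd. lra.
  - rewrite Rmin_left, Rmax_right in Hc by exact Hy. cbv beta in E.
    rewrite Rplus_0_r, ln_1 in E.
    assert (0 <= c ^ 2 / ((1 + c) * (2 + c) ^ 2)).
    { apply Rle_mult_inv_pos; [apply pow2_ge_0|].
      apply Rmult_lt_0_compat; [lra | apply pow_lt; lra]. }
    assert (0 <= c ^ 2 / ((1 + c) * (2 + c) ^ 2) * (y - 0)) by (apply Rmult_le_pos; lra).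
    lra.
Qed.

(** The quotient of the right-hand sides for consecutive [n] is at least [n + 1]
   precisely when [(n + 1/2) ln (1 + 1/n) >= 1]. The exponent [1/2] of [sqrt n] is
   sharp; any exponent below 1 would be enough for the limit. *)
Lemma factorial_le_Stirling (m : nat) :
  let n := INR (S m) in
  INR (fact (S m)) <= exp (1 + ln n / 2 + n * ln n - n).
Proof.
  cbv zeta. induction m as [|m IH].
  - simpl. rewrite ln_1. apply Req_le. rewrite <- exp_0. f_equal. field.
  - change (fact (S (S m))) with (S (S m) * fact (S m))%nat. rewrite mult_INR.
    set (n := INR (S m)) in *. rewrite (S_INR (S m)). fold n.
    assert (Hn : 0 < n) by (apply lt_0_INR; lia).
    assert (Hln : 1 <= (n + 1 / 2) * (ln (n + 1) - ln n)).
    { assert (H := ln_plus_1_bound (/ n)). 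
      replace (1 + / n) with ((n + 1) / n) in H by (field; lra).
      rewrite ln_div in H by lra.
      apply Rle_trans with ((n + 1 / 2) * (2 * / n / (2 + / n))).
      - apply Req_le. field. repeat split; nra.
      - apply Rmult_le_compat_l; [lra|]. apply H. left; now apply Rinv_0_lt_compat. }
    apply Rle_trans with ((n + 1) * exp (1 + ln n / 2 + n * ln n - n)).
    + apply Rmult_le_compat_l; [lra | exact IH].
    + rewrite <- (exp_ln (n + 1)) at 1 by lra. rewrite <- exp_plus.
      apply exp_le. lra.
Qed.

(** * The saddle-point estimate and the product with the gamma integral *)

Lemma Cexp_minus_1_bound (w : C) : Cmod (Cexp w - 1) <= Cmod w * exp (Cmod w).
Proof.
  assert (H : is_RInt (V := C_R_NormedModule) (fun t => w * Cexp (t * w))%C 0 1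
    (@minus C_R_NormedModule (Cexp (1 * w)) (Cexp (0 * w)))).
  { apply (is_RInt_derive (V := C_R_CompleteNormedModule) (fun t => Cexp (t * w))).
    - intros t _. evar_last.
      + apply is_derive_Cexp, is_derive_Cmult; [apply is_derive_RtoC_id | apply is_derive_Cconst].
      + eq_in_C. ring.
    - intros t _. apply continuous_Cmult; [apply continuous_const|].
      apply continuous_Cexp, continuous_Cmult; [|apply continuous_const].
      apply continuous_RtoC, continuous_id. }
  replace (@minus C_R_NormedModule (Cexp (1 * w)) (Cexp (0 * w))) with (Cexp w - 1)%C in H.
  2: { rewrite Cmult_1_l. replace (0 * w)%C with (RtoC 0) by ring. now rewrite Cexp_0. }
  rewrite <- norm_C. replace (Cmod w * exp (Cmod w)) with ((1 - 0) * (Cmod w * exp (Cmod w))) by ring.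
  refine (norm_RInt_le_const (V := C_R_NormedModule) _ _ _ _ _ _ _ H); [lra|].
  intros t Ht. rewrite norm_C, Cmod_mult, Cmod_Cexp.
  apply Rmult_le_compat_l; [apply Cmod_ge_0|]. apply exp_le.
  replace (Re (t * w)) with (t * Re w) by (unfold Re; simpl; ring).
  assert (H1 := re_le_Cmod w). assert (H2 := Rle_abs (Re w)). assert (H3 := Cmod_ge_0 w).
  apply Rle_trans with (t * Cmod w).
  - apply Rmult_le_compat_l; lra.
  - assert (t * Cmod w <= 1 * Cmod w) by (apply Rmult_le_compat_r; lra). lra.
Qed.

Lemma Im_le_Cmod (z : C) : Rabs (Im z) <= Cmod z.
Proof. apply Rle_trans with (2 := Rmax_Cmod z). apply Rmax_r. Qed.

(** [t e^(- k t^2)] has an elementary primitive, and the integral of [|t| e^(- k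
   t^2)] over either half-line is [1 / (2 k)]. *)
Lemma norm_RInt_Gaussian_moment (f : R -> C) (l : C) (B K k : R) : 0 < B -> 0 < k -> 0 <= K ->
  (forall t, continuous f t) ->
  (forall t, Rabs t <= B -> Cmod (f t) <= K * (Rabs t * exp (- (k * t ^ 2)))) ->
  is_RInt (V := C_R_NormedModule) f (- B) B l -> Cmod l <= K / k.
Proof.
  intros HB Hk HK Hf Hle Hl.
  assert (Hint : forall a b, is_RInt (V := C_R_NormedModule) f a b (RInt (V := C_R_CompleteNormedModule) f a b)).
  { intros a b. apply (RInt_correct (V := C_R_CompleteNormedModule)).
    apply (ex_RInt_continuous (V := C_R_CompleteNormedModule)). auto. }
  assert (E : l = (RInt (V := C_R_CompleteNormedModule) f (- B) 0 +
     RInt (V := C_R_CompleteNormedModule) f 0 B)%C).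
  { assert (H := is_RInt_Chasles (V := C_R_NormedModule) _ _ _ _ _ _ (Hint (- B) 0) (Hint 0 B)).
    apply (is_RInt_unique (V := C_R_CompleteNormedModule)) in H.
    apply (is_RInt_unique (V := C_R_CompleteNormedModule)) in Hl.
    rewrite <- Hl. exact H. }
  assert (Hg : forall c a b : R, is_RInt (V := R_NormedModule)
     (fun t => c * (K * (t * exp (- (k * t ^ 2))))) a b
     (minus (c * (- (K / (2 * k)) * exp (- (k * b ^ 2)))) (c * (- (K / (2 * k)) * exp (- (k * a ^ 2)))))).
  { intros c a b. apply (is_RInt_derive (V := R_CompleteNormedModule)
      (fun t => c * (- (K / (2 * k)) * exp (- (k * t ^ 2))))).
    - intros t _. auto_derive; [trivial|]. simpl. field. lra.
    - intros t _. apply (ex_derive_continuous (V := R_NormedModule)). auto_derive; trivial. }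
  assert (HP := exp_pos (- (k * B ^ 2))).
  assert (HKk : 0 <= K / (2 * k)) by (apply Rle_mult_inv_pos; lra).
  assert (HPP : 0 <= K / (2 * k) * exp (- (k * B ^ 2))) by (apply Rmult_le_pos; lra).
  assert (H0 : exp (- (k * 0 ^ 2)) = 1) by (rewrite <- exp_0; f_equal; ring).
  assert (HmB : exp (- (k * (- B) ^ 2)) = exp (- (k * B ^ 2))) by (f_equal; ring).
  assert (B1 : Cmod (RInt (V := C_R_CompleteNormedModule) f 0 B) <= K / (2 * k)).
  { rewrite <- norm_C.
    eapply Rle_trans; [refine (norm_RInt_le (V := C_R_NormedModule) _ _ _ _ _ _ _ _ (Hint 0 B) (Hg 1 0 B))|].
    - lra.
    - intros t Ht. rewrite norm_C. apply Rle_trans with (1 := Hle t ltac:(apply Rabs_le; lra)).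
      rewrite Rabs_pos_eq by lra. lra.
    - unfold minus, plus, opp; simpl. simpl in H0. rewrite H0. simpl in HPP. lra. }
  assert (B2 : Cmod (RInt (V := C_R_CompleteNormedModule) f (- B) 0) <= K / (2 * k)).
  { rewrite <- norm_C.
    eapply Rle_trans; [refine (norm_RInt_le (V := C_R_NormedModule) _ _ _ _ _ _ _ _ (Hint (- B) 0) (Hg (-1) (- B) 0))|].
    - lra.
    - intros t Ht. rewrite norm_C. apply Rle_trans with (1 := Hle t ltac:(apply Rabs_le; lra)).
      rewrite Rabs_left1 by lra. lra.
    - unfold minus, plus, opp; simpl. simpl in H0, HmB. rewrite H0, HmB. simpl in HPP. lra. }
  rewrite E. apply Rle_trans with (1 := Cmod_triangle _ _).
  replace (K / k) with (K / (2 * k) + K / (2 * k)) by (field; lra). lra.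
Qed.

Lemma Cmod_lim_le (f : R -> C) (l x : C) (B : R) :
  filterlim f (Rbar_locally p_infty) (locally l) ->
  Rbar_locally p_infty (fun r => Cmod (f r - x) <= B) -> Cmod (l - x) <= B.
Proof.
  intros Hf HB. apply Rnot_lt_le. intros H.
  apply filterlim_Cmod in Hf; [|exact _].
  assert (He : 0 < Cmod (l - x) - B) by lra.
  destruct (filter_ex _ (filter_and _ _ HB (proj1 (filterlim_locally _ _) Hf (mkposreal _ He)))) as [r [H1 H2]].
  change (Rabs (Cmod (f r - l) - 0) < Cmod (l - x) - B) in H2.
  rewrite Rminus_0_r, Rabs_pos_eq in H2 by apply Cmod_ge_0.
  assert (H3 := Cmod_triangle (f r - x) (l - f r)).
  replace (f r - x + (l - f r))%C with (l - x)%C in H3 by ring.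
  replace (l - f r)%C with (- (f r - l))%C in H3 by ring. rewrite Cmod_opp in H3. lra.
Qed.

(** What remains is the difference of the two ray integrals from [r0] on, along the
   banks of the cut, where the integrand has modulus at most [r0^(- Re s) e^(- r)]
   up to a constant. Only [Im s] enters the constant, which stays bounded when [s]
   is shifted by integers. *)
Lemma arc_integral_tail (s I : C) (r0 : R) : 1 <= r0 -> 0 <= Re s ->
  arc_limit s (- PI) PI I ->
  Cmod (I - arc_integral s (- PI) PI r0) <=
    2 * exp (PI * Rabs (Im s)) * exp (- Re s * ln r0) * exp (- r0).
Proof.
  intros Hr0 Hs HI. assert (HPI := PI_RGT_0).
  set (K := 2 * exp (PI * Rabs (Im s)) * exp (- Re s * ln r0)).
  assert (HK : 0 <= K).
  { apply Rmult_le_pos; [|apply Rlt_le, exp_pos].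
    apply Rmult_le_pos; [lra | apply Rlt_le, exp_pos]. }
  apply Cmod_lim_le with (1 := HI). exists r0. intros r Hr.
  assert (Hg : is_RInt (V := R_NormedModule) (fun x => K * exp (- x)) r0 r
    (minus (- (K * exp (- r))) (- (K * exp (- r0))))).
  { apply (is_RInt_derive (V := R_CompleteNormedModule) (fun x => - (K * exp (- x)))).
    - intros x _. auto_derive; [trivial|]. ring.
    - intros x _. apply (ex_derive_continuous (V := R_NormedModule)). auto_derive; trivial. }
  assert (Hbank : forall x b, r0 <= x -> cos b = - 1 -> Rabs b = PI ->
      Cmod (ray_integrand s x b) <= K / 2 * exp (- x)).
  { intros x b Hx Hcos Hb. rewrite Cmod_ray_integrand, Hcos.
    replace (K / 2) with (exp (PI * Rabs (Im s)) * exp (- Re s * ln r0)) by (unfold K; field).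
    rewrite <- !exp_plus. apply exp_le.
    assert (Im s * b <= PI * Rabs (Im s)).
    { apply Rle_trans with (1 := Rle_abs _). rewrite Rabs_mult, Hb. lra. }
    assert (Re s * ln r0 <= Re s * ln x) by (apply Rmult_le_compat_l; [exact Hs | apply ln_le; lra]).
    lra. }
  rewrite <- norm_C.
  eapply Rle_trans; [refine (norm_RInt_le (V := C_R_NormedModule) _ _ _ _ _ _ _ _
    (is_RInt_ray_difference s (- PI) PI r0 r _ _) Hg)|].
  - lra.
  - intros x Hx. rewrite norm_C.
    apply Rle_trans with (1 := Cmod_triangle _ _). rewrite Cmod_opp.
    assert (H1 := Hbank x PI (proj1 Hx) cos_PI (Rabs_pos_eq PI ltac:(lra))).
    assert (H2 := Hbank x (- PI) (proj1 Hx) ltac:(rewrite cos_neg; exact cos_PI)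
      ltac:(rewrite Rabs_Ropp; apply Rabs_pos_eq; lra)).
    lra.
  - lra.
  - lra.
  - assert (0 <= K * exp (- r)) by (apply Rmult_le_pos; [exact HK | apply Rlt_le, exp_pos]).
    unfold minus, plus, opp; simpl. lra.
Qed.

(** At radius [n] the two integrands differ by the factor [e^(- i z theta) - 1],
   which is of order [|theta|], while [e^(n cos theta)] is at most [e^n] times the
   Gaussian [e^(- n theta^2 / 18)]. The first moment of that Gaussian is of order [1
   / n], not just [1 / sqrt n], which leaves a factor [1 / sqrt n] to spare after
   Stirling's bound. *)
Lemma arc_integral_saddle (n : R) (z : C) : 1 <= n ->
  Cmod (Rpow_C n z * arc_integral (z + n) (- PI) PI n - arc_integral n (- PI) PI n) <=
  Cmod z * exp (PI * Cmod z) * exp (n + (1 - n) * ln n) * (18 / n).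
Proof.
  intros Hn.
  set (K := Cmod z * exp (PI * Cmod z) * exp (n + (1 - n) * ln n)).
  assert (HPI := PI_RGT_0). assert (Hn0 : 0 < n) by lra.
  assert (HK : 0 <= K).
  { apply Rmult_le_pos; [|apply Rlt_le, exp_pos].
    apply Rmult_le_pos; [apply Cmod_ge_0 | apply Rlt_le, exp_pos]. }
  replace (K * (18 / n)) with (K / (n / 18)) by (field; lra).
  assert (HI := is_RInt_minus (V := C_R_NormedModule) _ _ _ _ _ _
    (is_RInt_Cmult_l (Rpow_C n z) _ _ _ _ (arc_integral_correct (z + n) (- PI) PI n Hn0))
    (arc_integral_correct n (- PI) PI n Hn0)).
  refine (norm_RInt_Gaussian_moment _ _ PI K (n / 18) HPI _ HK _ _ HI).
  - lra.
  - intros t. apply (continuous_minus (V := C_R_NormedModule)).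
    + apply continuous_Cmult; [apply continuous_const | now apply continuous_arc_integrand_theta].
    + now apply continuous_arc_integrand_theta.
  - intros t Ht.
    change (Cmod (Rpow_C n z * arc_integrand (z + n) n t - arc_integrand n n t) <=
      K * (Rabs t * exp (- (n / 18 * t ^ 2)))).
    assert (E : (Rpow_C n z * arc_integrand (z + n) n t - arc_integrand n n t =
      arc_integrand n n t * (Cexp (- (z * (Ci * t))) - 1))%C).
    { assert (E0 : (polar_power n t (- (z + n)) * Rpow_C n z =
         polar_power n t (- n) * Cexp (- (z * (Ci * t))))%C).
      { unfold polar_power, Rpow_C. rewrite <- !Cexp_plus. f_equal. ring. }
      unfold arc_integrand, Hankel_kernel.
      transitivity (Cexp (polar n t) * (polar_power n t (- (z + n)) * Rpow_C n z) * (Ci * polar n t)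
        - Cexp (polar n t) * polar_power n t (- n) * (Ci * polar n t))%C; [ring|].
      rewrite E0. ring. }
    rewrite E, Cmod_mult, Cmod_arc_integrand by exact Hn0.
    assert (Hw : Cmod (- (z * (Ci * t))) = Cmod z * Rabs t).
    { rewrite Cmod_opp, !Cmod_mult, Cmod_R. rewrite Cmod_Ci. ring. }
    assert (B := Cexp_minus_1_bound (- (z * (Ci * t)))). rewrite Hw in B.
    assert (Hz := Cmod_ge_0 z). assert (Ht0 := Rabs_pos t).
    apply Rle_trans with (exp (n - n / 18 * t ^ 2 + (1 - n) * ln n) * (Cmod z * Rabs t * exp (PI * Cmod z))).
    + apply Rmult_le_compat; [apply Rlt_le, exp_pos | apply Cmod_ge_0 | |].
      * apply exp_le. replace (Re n) with n by reflexivity. replace (Im n) with 0 by reflexivity.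
        assert (Hc := cos_le_quadratic t Ht).
        assert (n * cos t <= n * (1 - t ^ 2 / 18)) by (apply Rmult_le_compat_l; lra). lra.
      * apply Rle_trans with (1 := B). apply Rmult_le_compat_l; [apply Rmult_le_pos; lra|].
        apply exp_le. rewrite Rmult_comm. apply Rmult_le_compat_r; lra.
    + replace (n - n / 18 * t ^ 2 + (1 - n) * ln n) with
        ((n + (1 - n) * ln n) + - (n / 18 * t ^ 2)) by ring.
      rewrite (exp_plus _ (- (n / 18 * t ^ 2))). unfold K. apply Req_le. ring.
Qed.

(** Replace the limit by the circle of radius [n] and then the exponent [z + n] by
   [n], where the value is exact. Both errors are at most of order [e^n n^(-n)]
   after multiplication by [n^z], and [(n - 1)! e^n n^(-n)] is at most
   [e / sqrt n]. *)
Lemma arc_limit_asymptotic (m : nat) (z I : C) : 0 <= Re z ->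
  let n := INR (S m) in
  arc_limit (z + n) (- PI) PI I ->
  Cmod (Rpow_C n z * I * INR (fact m) - 2 * PI * Ci) <=
    (2 + 18 * Cmod z) * exp (PI * Cmod z) * exp 1 / sqrt n.
Proof.
  intros Hz n HI.
  assert (HPI := PI_RGT_0). assert (HT := exp_pos (PI * Cmod z)). assert (Hcz := Cmod_ge_0 z).
  assert (Hn : 1 <= n) by (unfold n; rewrite S_INR; generalize (pos_INR m); lra).
  assert (Hln : 0 <= ln n) by (rewrite <- ln_1; apply ln_le; lra).
  assert (Hf := INR_fact_lt_0 m). set (f := INR (fact m)) in *.
  assert (Hre : Re (z + n) = Re z + n) by reflexivity.
  assert (Him : Im (z + n) = Im z) by (unfold Im; simpl; ring).
  assert (T1 := arc_integral_tail (z + n) I n Hn ltac:(rewrite Hre; lra) HI).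
  assert (T2 := arc_integral_saddle n z Hn).
  rewrite Hre, Him in T1.
  assert (E : (Rpow_C n z * I * f - 2 * PI * Ci =
    f * (Rpow_C n z * (I - arc_integral (z + n) (- PI) PI n) +
     (Rpow_C n z * arc_integral (z + n) (- PI) PI n - arc_integral n (- PI) PI n)))%C).
  { rewrite <- (arc_integral_nat m n) by lra. fold n. fold f. ring. }
  rewrite E, Cmod_mult, Cmod_R, Rabs_pos_eq by lra.
  set (G := (2 + 18 * Cmod z) * exp (PI * Cmod z)).
  assert (HG : 0 <= G) by (apply Rmult_le_pos; lra).
  apply Rle_trans with (f * (G * exp (n - n * ln n))).
  - apply Rmult_le_compat_l; [lra|].
    apply Rle_trans with (1 := Cmod_triangle _ _). rewrite Cmod_mult, Cmod_Rpow_C.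
    assert (U1 : exp (Re z * ln n) * Cmod (I - arc_integral (z + n) (- PI) PI n) <=
      2 * exp (PI * Cmod z) * exp (n - n * ln n)).
    { apply Rle_trans with (exp (Re z * ln n) *
        (2 * exp (PI * Rabs (Im z)) * exp (- (Re z + n) * ln n) * exp (- n))).
      { apply Rmult_le_compat_l; [apply Rlt_le, exp_pos | exact T1]. }
      replace (exp (Re z * ln n) * (2 * exp (PI * Rabs (Im z)) * exp (- (Re z + n) * ln n) * exp (- n)))
        with (2 * (exp (PI * Rabs (Im z)) * exp (Re z * ln n + - (Re z + n) * ln n + - n)))
        by (rewrite !exp_plus; ring).
      rewrite (Rmult_assoc 2). apply Rmult_le_compat_l; [lra|].
      apply Rmult_le_compat; try apply Rlt_le, exp_pos; apply exp_le.
      - apply Rmult_le_compat_l; [lra | apply Im_le_Cmod].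
      - lra. }
    assert (U2 : exp (n + (1 - n) * ln n) * / n = exp (n - n * ln n)).
    { replace (/ n) with (exp (- ln n)) by (rewrite exp_Ropp, exp_ln; [reflexivity | lra]).
      rewrite <- exp_plus. f_equal. ring. }
    replace (Cmod z * exp (PI * Cmod z) * exp (n + (1 - n) * ln n) * (18 / n)) with
      (18 * Cmod z * exp (PI * Cmod z) * (exp (n + (1 - n) * ln n) * / n)) in T2 by (unfold Rdiv; ring).
    rewrite U2 in T2. unfold G. lra.
  - assert (S1 := factorial_le_Stirling m). cbv zeta in S1. fold n in S1.
    change (fact (S m)) with (S m * fact m)%nat in S1. rewrite mult_INR in S1. fold n f in S1.
    assert (Hsq : sqrt n = exp (ln n / 2)).
    { rewrite <- Rpower_sqrt by lra. unfold Rpower. f_equal. field. }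
    assert (S2 : f * exp (n - n * ln n) <= exp 1 / sqrt n).
    { apply Rmult_le_reg_l with n; [lra|].
      apply Rle_trans with (exp (1 + ln n / 2 + n * ln n - n) * exp (n - n * ln n)).
      { rewrite <- Rmult_assoc. apply Rmult_le_compat_r; [apply Rlt_le, exp_pos | exact S1]. }
      rewrite <- exp_plus, Hsq. unfold Rdiv. rewrite <- exp_Ropp.
      apply Rle_trans with (exp (ln n) * (exp 1 * exp (- (ln n / 2))));
        [|rewrite exp_ln by lra; apply Rle_refl].
      rewrite <- !exp_plus. apply Req_le. f_equal. field. }
    replace (f * (G * exp (n - n * ln n))) with (G * (f * exp (n - n * ln n))) by ring.
    replace (G * exp 1 / sqrt n) with (G * (exp 1 / sqrt n)) by (unfold Rdiv; ring).
    now apply Rmult_le_compat_l.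
Qed.

Lemma ex_arc_limit (s : C) : exists I, arc_limit s (- PI) PI I.
Proof.
  destruct (contour_integral_arc_limit s 1 0 PI PI) as [I [_ HI]].
  - lra.
  - rewrite Rplus_0_r, cos_neg, cos_PI. lra.
  - rewrite Rplus_0_r, cos_PI. lra.
  - exists I. rewrite !Rplus_0_r in HI. exact HI.
Qed.

Lemma arc_limit_PI_rec (s I J : C) :
  arc_limit s (- PI) PI I -> arc_limit (s + 1) (- PI) PI J -> I = (s * J)%C.
Proof.
  intros HI HJ. apply (arc_limit_unique s (- PI) PI); [exact HI|].
  apply arc_limit_rec; [| |exact HJ].
  - rewrite cos_neg, cos_PI. lra.
  - rewrite cos_PI. lra.
Qed.

(** The factor [z] that the arc limit loses under [z -> z + 1] is the one that the
   gamma integral gains. *)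
Lemma arc_limit_mult_Gamma_shift (z I J : C) (n : nat) : 0 < Re z ->
  arc_limit z (- PI) PI I -> arc_limit (z + INR n) (- PI) PI J ->
  (I * Gamma_integral z = J * Gamma_integral (z + INR n))%C.
Proof.
  intros Hz HI. revert J. induction n as [|n IH]; intros J HJ.
  - simpl INR in *. replace (z + 0)%C with z in * by ring.
    now rewrite (arc_limit_unique _ _ _ _ _ HI HJ).
  - destruct (ex_arc_limit (z + INR n)) as [J' HJ'].
    assert (E : (z + INR (S n) = z + INR n + 1)%C) by (rewrite S_INR, RtoC_plus; ring).
    rewrite E in HJ |- *.
    rewrite (IH J' HJ'), Gamma_integral_succ, (arc_limit_PI_rec _ _ _ HJ' HJ).
    + ring.
    + change (0 < Re z + INR n). generalize (pos_INR n). lra.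
Qed.

Lemma eq_of_inv_sqrt_bound (x y : C) (K : R) :
  (forall m : nat, Cmod (x - y) <= K / sqrt (INR (S m))) -> x = y.
Proof.
  intros H.
  assert (H0 : Cmod (x - y) <= 0).
  { apply Rnot_lt_le. intros Hd. set (d := Cmod (x - y)) in *.
    assert (HK : 0 < K).
    { specialize (H 0%nat). simpl in H. rewrite sqrt_1 in H. lra. }
    destruct (nfloor_ex ((K / d) ^ 2)) as [m [_ Hm]]; [apply pow2_ge_0|].
    specialize (H m). rewrite S_INR in H.
    assert (Hq : 0 < K / d) by now apply Rdiv_lt_0_compat.
    assert (Hs : K / d < sqrt (INR m + 1)).
    { rewrite <- (sqrt_pow2 (K / d)) by lra. apply sqrt_lt_1; [apply pow2_ge_0 | | exact Hm].
      generalize (pos_INR m); lra. }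
    assert (K < d * sqrt (INR m + 1)).
    { replace K with (d * (K / d)) by (field; lra). now apply Rmult_lt_compat_l. }
    assert (K / sqrt (INR m + 1) < d).
    { apply Rmult_lt_reg_r with (sqrt (INR m + 1)); [lra|].
      replace (K / sqrt (INR m + 1) * sqrt (INR m + 1)) with K by (field; lra). exact H0. }
    lra. }
  assert (E : (x - y = 0)%C) by (apply Cmod_eq_0; generalize (Cmod_ge_0 (x - y)); lra).
  replace x with (x - y + y)%C by ring. rewrite E. ring.
Qed.

(** The product does not change under [z -> z + n], and at [z + n] it is within a
   constant over [sqrt n] of [2 pi i] for every [n]. *)
Lemma arc_limit_mult_Gamma_strip (z I : C) : 1 <= Re z <= 2 ->
  arc_limit z (- PI) PI I -> (I * Gamma_integral z = 2 * PI * Ci)%C.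
Proof.
  intros Hz HI. assert (HPI := PI_RGT_0).
  set (K1 := (2 + 18 * Cmod z) * exp (PI * Cmod z) * exp 1).
  set (K2 := 3 * Cmod z).
  assert (Hcz := Cmod_ge_0 z).
  assert (HK1 : 0 <= K1).
  { assert (H := exp_pos (PI * Cmod z)). assert (H1 := exp_pos 1).
    apply Rmult_le_pos; [apply Rmult_le_pos|]; lra. }
  apply eq_of_inv_sqrt_bound with (K1 * (1 + K2) + 2 * PI * K2). intros m.
  set (n := INR (S m)).
  assert (Hn : 1 <= n) by (unfold n; rewrite S_INR; generalize (pos_INR m); lra).
  assert (Hsq : 1 <= sqrt n) by (rewrite <- sqrt_1; apply sqrt_le_1; lra).
  assert (Hf := INR_fact_lt_0 m).
  destruct (ex_arc_limit (z + n)) as [J HJ].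
  assert (HA := arc_limit_asymptotic m z J ltac:(lra) HJ).
  assert (HB := Gamma_asymptotic m z Hz). cbv zeta in HA, HB. fold n in HA, HB.
  rewrite (arc_limit_mult_Gamma_shift z I J (S m)) by (lra || assumption). fold n.
  set (f := INR (fact m)) in *. set (G := Gamma_integral (z + n)) in *.
  set (p := Rpow_C n z) in *.
  assert (Hp : Cmod p = exp (Re z * ln n)) by apply Cmod_Rpow_C.
  assert (Hp0 : p <> 0%C) by apply Cexp_neq_0.
  assert (Hf0 : RtoC f <> 0%C) by (intros E; apply RtoC_inj in E; lra).
  assert (HB' : Cmod (G / (p * f) - 1) <= K2 / sqrt n).
  { assert (Hpf : 0 < Cmod (p * f)).
    { rewrite Cmod_mult, Hp, Cmod_R, Rabs_pos_eq by lra.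
      apply Rmult_lt_0_compat; [apply exp_pos | exact Hf]. }
    apply Rmult_le_reg_r with (Cmod (p * f)); [exact Hpf|].
    rewrite <- Cmod_mult.
    replace ((G / (p * f) - 1) * (p * f))%C with (G - p * f)%C by (field; auto).
    apply Rle_trans with (1 := HB).
    rewrite Cmod_mult, Hp, Cmod_R, Rabs_pos_eq by lra.
    apply Req_le. unfold K2. field. lra. }
  fold K1 in HA.
  set (A := (p * J * f)%C) in *. set (B := (G / (p * f))%C) in *.
  set (T := (2 * PI * Ci)%C) in *.
  assert (HT : Cmod T = 2 * PI).
  { unfold T. rewrite !Cmod_mult, !Cmod_R, !Rabs_pos_eq by lra.
    rewrite Cmod_Ci. ring. }
  assert (HAB : (J * G)%C = (A * B)%C) by (unfold A, B; field; auto).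
  rewrite HAB. replace (A * B - T)%C with ((A - T) * B + T * (B - 1))%C by ring.
  apply Rle_trans with (1 := Cmod_triangle _ _). rewrite !Cmod_mult, HT.
  assert (Hinv : 0 < / sqrt n <= 1).
  { split; [apply Rinv_0_lt_compat; lra|]. rewrite <- Rinv_1. apply Rinv_le_contravar; lra. }
  assert (HBle : Cmod B <= 1 + K2).
  { replace B with (1 + (B - 1))%C by ring. apply Rle_trans with (1 := Cmod_triangle _ _).
    rewrite Cmod_1. apply Rplus_le_compat_l. apply Rle_trans with (1 := HB').
    unfold Rdiv. rewrite <- (Rmult_1_r K2) at 2. apply Rmult_le_compat_l; unfold K2; lra. }
  assert (V1 : Cmod (A - T) * Cmod B <= K1 / sqrt n * (1 + K2)).
  { apply Rmult_le_compat; try apply Cmod_ge_0; assumption. }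
  assert (V2 : 2 * PI * Cmod (B - 1) <= 2 * PI * (K2 / sqrt n)) by (apply Rmult_le_compat_l; lra).
  unfold Rdiv in *. lra.
Qed.

Lemma arc_limit_mult_Gamma (z I : C) : 0 < Re z ->
  arc_limit z (- PI) PI I -> (I * Gamma_integral z = 2 * PI * Ci)%C.
Proof.
  assert (H : forall (k : nat) (z I : C), INR k < Re z <= INR k + 1 ->
    arc_limit z (- PI) PI I -> (I * Gamma_integral z = 2 * PI * Ci)%C).
  { clear. intros k. induction k as [|k IH]; intros z I Hz HI.
    (* The strip [0 < Re z <= 1] is moved one step to the right into the range of
       the estimates; the strips further right are moved to the left, one step at a
       time. *)
    - simpl INR in Hz. destruct (ex_arc_limit (z + INR 1)) as [J HJ].
      rewrite (arc_limit_mult_Gamma_shift z I J 1) by (lra || assumption).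
      apply arc_limit_mult_Gamma_strip; [|exact HJ].
      change (1 <= Re z + 1 <= 2). lra.
    - rewrite S_INR in Hz. assert (Hk := pos_INR k).
      destruct (ex_arc_limit (z - 1)) as [J HJ].
      assert (Hre : Re (z - 1) = Re z - 1) by reflexivity.
      assert (E : (z - 1 + INR 1)%C = z) by (simpl; ring).
      rewrite <- (IH (z - 1)%C J) by (rewrite ?Hre; lra || assumption).
      rewrite (arc_limit_mult_Gamma_shift (z - 1) J I 1).
      + now rewrite E.
      + lra.
      + exact HJ.
      + now rewrite E. }
  intros Hz HI.
  destruct (nfloor1_ex (Re z) Hz) as [k Hk]. now apply (H k).
Qed.

Lemma arc_limit_rising (s I J : C) (n : nat) :
  arc_limit s (- PI) PI I -> arc_limit (s + INR n) (- PI) PI J ->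
  I = (rising s n * J)%C.
Proof.
  intros HI. revert J. induction n as [|n IH]; intros J HJ.
  - simpl INR in *. simpl rising. replace (s + 0)%C with s in * by ring.
    rewrite (arc_limit_unique _ _ _ _ _ HI HJ). ring.
  - destruct (ex_arc_limit (s + INR n)) as [J' HJ'].
    assert (E : (s + INR (S n) = s + INR n + 1)%C) by (rewrite S_INR, RtoC_plus; ring).
    rewrite E in HJ. simpl rising.
    rewrite (IH J' HJ'), (arc_limit_PI_rec _ _ _ HJ' HJ). ring.
Qed.

Theorem lemma1 :
  forall eps delta1 delta2 psi : R,
    0 < eps ->
    PI / 2 < delta1 <= PI ->
    PI / 2 < delta2 <= PI ->
    PI / 2 - delta2 < psi < - (PI / 2) + delta1 ->
    forall s : C,
      exists I : C,
        is_gamma_contour_integral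
          (fun r theta : R => (Cexp (polar r theta) * polar_power r theta (- s))%C)
          eps psi delta1 delta2 I /\
        recip_Gamma s = (1 / (2 * PI * Ci) * I)%C.
Proof.
  intros eps delta1 delta2 psi Heps Hd1 Hd2 Hpsi s. assert (HPI := PI_RGT_0).
  destruct (contour_integral_arc_limit s eps psi delta1 delta2) as [I [HI HL]].
  - exact Heps.
  - rewrite <- cos_neg. apply cos_lt_0; lra.
  - apply cos_lt_0; lra.
  - exists I. split; [exact HI|].
    apply arc_limit_full_circle in HL; [|lra|lra].
    set (n := Gamma_shift s).
    destruct (ex_arc_limit (s + INR n)) as [J HJ].
    assert (HJG : (J * Gamma_integral (s + INR n) = 2 * PI * Ci)%C).
    { apply arc_limit_mult_Gamma; [apply Gamma_shift_pos | exact HJ]. }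
    assert (HT : (2 * PI * Ci)%C <> 0%C).
    { intros E. apply (f_equal Im) in E. unfold Im in E; simpl in E. lra. }
    assert (HG : Gamma_integral (s + INR n) <> 0%C).
    { intros E. apply HT. rewrite <- HJG, E. ring. }
    assert (HJ0 : J <> 0%C).
    { intros E. apply HT. rewrite <- HJG, E. ring. }
    rewrite (arc_limit_rising s I J n HL HJ), <- HJG.
    unfold recip_Gamma. fold n. field. auto.
Qed.
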